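(* Let $\ell$ be a positive integer and let $Y$ be an $\ell$-decent real random variable. For $t \in (0,1)$ consider the operator $A_t$ given by $$(A_t f)(x) = \mathbb{E} f(x \oplus tY).$$ Then there exists a constant $c > 0$ which depends only on the distribution of $Y$ (in particular not on $t$, $p$ or $f$) such that for every $t \in (0,1)$, every $1 \leq p \leq \infty$ and every $f \in L_p(\mathbb{T})$ with $\int_{\mathbb{T}} f = 0$ we have $$\| f - A_t f \| \geq c t^2 \| f \|,$$ where $\|\cdot\|$ denotes the $L_p(\mathbb{T})$ norm.
   Context: $\mathbb{T} = \mathbb{R}/\mathbb{Z}$ is the one-dimensional torus, a compact group with addition modulo 1, $x \oplus y = (x+y) \bmod 1$ for $x, y \in \mathbb{R}$, equipped with its Haar probability measure (Lebesgue measure on $[0,1)$). The $L_p(\mathbb{T})$ norm is $\|f\| = \left(\int_{\mathbb{T}} |f|^p\right)^{1/p}$ for $1 \le p < \infty$ and $\|f\| = \mathrm{ess\,sup}_{\mathbb{T}} |f|$ for $p = \infty$. A real random variable $Y$ is called $\ell$-decent if the law of $Y_1 + \ldots + Y_\ell$ has a nontrivial (nonzero) absolutely continuous part with respect to Lebesgue measure on $\mathbb{R}$ (in the Lebesgue decomposition), where $Y_1, Y_2, \ldots$ are i.i.d. copies of $Y$. *)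

(* Defs.v *)
From HB Require Import structures.
From mathcomp Require Import all_boot all_order all_algebra.
From mathcomp Require Import all_classical all_reals all_analysis.

Set Implicit Arguments.
Unset Strict Implicit.
Unset Printing Implicit Defensive.

Import Order.TTheory GRing.Theory Num.Theory.
Import numFieldNormedType.Exports.

Local Open Scope classical_set_scope.
Local Open Scope ring_scope.

Section Torus.
Variable R : realType.

(* Points of R/Z are represented by reals in [0, 1[, and functions on R/Z by
   functions on R whose values outside [0, 1[ are irrelevant: [haarT] does not
   charge the complement of [0, 1[, and [addT] takes its values in [0, 1[. *)
Definition addT (x y : R) : R := x + y - (Num.floor (x + y))%:~R.

Definition haarT : {measure set (measurableTypeR R) -> \bar R} :=
  mrestr (@lebesgue_measure R) (measurable_itv `[(0 : R), 1[).

(* For f in L_1(R/Z) the expectation is finite for almost every x; on the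
   exceptional null set [fine] only provides a default value. *)
Definition avg_op d (T : measurableType d) (P : probability T R)
    (Y : {RV P >-> R}) (t : R) (f : R -> R) (x : R) : R :=
  fine 'E_P[fun w => f (addT x (t * Y w))].

End Torus.

Section RandomVariables.
Variable R : realType.

(* Equality is required on measurable sets only, since the value of a library
   measure on other sets is unspecified. *)
Definition same_law d (T : measurableType d) (P : probability T R)
    d' (T' : measurableType d') (P' : probability T' R)
    (X : {RV P >-> R}) (X' : {RV P' >-> R}) : Prop :=
  forall B : set R, measurable B -> distribution P X B = distribution P' X' B.

(* The product rule over subfamilies is the case where some [B i] is [setT]. *)
Definition mutually_independent d (T : measurableType d) (P : probability T R)
    (n : nat) (X : 'I_n -> {RV P >-> R}) : Prop :=
  forall B : 'I_n -> set R, (forall i, measurable (B i)) ->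
    P (\bigcap_(i in [set: 'I_n]) (X i @^-1` B i)) =
    (\prod_(i < n) P (X i @^-1` B i))%E.

Definition mutually_singular (mu nu : set (measurableTypeR R) -> \bar R) :=
  exists N : set R, [/\ measurable N, nu N = 0%E & mu (~` N) = 0%E].

(* The absolutely continuous part [mua] in the Lebesgue decomposition
   [mu = mua + mus] is nonzero. *)
Definition has_ac_part (mu : set (measurableTypeR R) -> \bar R) : Prop :=
  exists mua mus : {measure set (measurableTypeR R) -> \bar R},
    [/\ forall B, measurable B -> mu B = (mua B + mus B)%E,
        mua `<< @lebesgue_measure R,
        mutually_singular mus (@lebesgue_measure R)
      & mua setT != 0%E].

Definition decent (l : nat) d (T : measurableType d) (P : probability T R)
    (Y : {RV P >-> R}) : Prop :=
  exists (d' : measure_display) (T' : measurableType d')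
         (Q : probability T' R) (Ys : 'I_l -> {RV Q >-> R}),
    [/\ forall i, same_law (Ys i) Y,
        mutually_independent Ys
      & has_ac_part (pushforward Q (fun w => \sum_(i < l) Ys i w))].

End RandomVariables.

(* Main.v *)
Require Import Defs.
From HB Require Import structures.
From mathcomp Require Import all_boot all_order all_algebra.
From mathcomp Require Import all_classical all_reals all_analysis.
From mathcomp Require Import ess_sup_inf measurable_realfun.
From mathcomp Require Import ring lra.

(** Functions on the circle are replaced by their periodic extensions [F] to the
line, and [A_t] becomes the averaging operator [conv_op k], where [k] is the law
of [t * Y]. The quantity to be bounded from below is the defect of [k], the norm
of [F - conv_op k F].

Of the L_p norms only two properties are used: the triangle inequality, and the
fact that averaging against a measure of mass 1, in particular a translation, is
a contraction ([torus_Lp_conv]). Neither involves a constant depending on [p].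

More steps. The defect is subadditive under convolution of kernels
([defect_convolution]). The law of a sum of [2 * l] independent copies of
[t * Y] therefore has at most [2 * l] times the defect of a single step, and it
suffices to treat the former ([defect_psum] for [l] steps, then a convolution
square).

A kernel with a flat part. By decency the law of the sum of [l] copies of [Y]
dominates a multiple of Lebesgue measure on a set of positive measure
([ac_part_minorant]). By the argument of Steinhaus, the law of the sum of
[2 * l] copies then dominates [delta] times Lebesgue measure on an interval of
half-length [b] ([steinhaus_convolution]). For [t * Y] this becomes [delta / t]
times Lebesgue measure on an interval of half-length [t * b].

Spectral gap. Let [k] dominate [beta] times Lebesgue measure on an interval
[[a - w, a + w[], where [w = 1 / M], let [eta] be the defect of [k], and let
[u i] be the norm of [F (x + i * w) - F x]. Applying [k] to this increment costs
at most [2 * eta]. Two copies of [F] at distance [i * w], averaged over the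
interval, can use its two halves in opposite order; this trades two increments
at distance [i] for one at distance [i - 1] and one at distance [i + 1]. Hence
[u i <= eta / (w * beta) + (u (i - 1) + u (i + 1)) / 2], and since
[u 0 = u M = 0] by periodicity, a discrete maximum principle gives
[u i <= eta / (w * beta) * i * (M - i)] ([discrete_max_principle]). Because [F]
has mean zero, its averages over the [M] arcs of length [w] add up to 0, so each
of them is controlled by the numbers [u i]; and [F] itself is close to its
average under [k], in which these arcs appear. Together the norm of [F] is at
most [(M + M ^ 3) / beta * eta] ([spectral_gap_arc]). With [M] of order
[1 / (t * b)] and [beta = delta / t] this is of order [eta / t ^ 2]. *)

Import Order.TTheory GRing.Theory Num.Theory.
Import numFieldNormedType.Exports.

Local Open Scope classical_set_scope.
Local Open Scope ring_scope.

Set Implicit Arguments.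
Unset Strict Implicit.
Unset Printing Implicit Defensive.

(** * Translations and Haar measure *)

Section Translation.
Variable R : realType.
Local Notation leb := (@lebesgue_measure R).
Local Open Scope ereal_scope.

Lemma measurable_shift (s : R) :
  measurable_fun [set: measurableTypeR R] (fun x : measurableTypeR R => (x + s)%R : measurableTypeR R).
Proof. exact: measurable_funD. Qed.

Lemma preimage_shift_itv (s a b : R) (x y : bool) :
  [set r | (r + s)%R \in Interval (BSide x a) (BSide y b)] =
  [set` Interval (BSide x (a - s)%R) (BSide y (b - s)%R)].
Proof.
by apply/seteqP; split => r /=; rewrite !in_itv /=; case: x; case: y => /=;
  rewrite ?lerBlDr ?ltrBlDr ?lerBrDr ?ltrBrDr.
Qed.

Lemma lebesgue_measure_shift (s : R) (A : set R) : measurable A ->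
  leb ((fun x => (x + s)%R) @^-1` A) = leb A.
Proof.
move=> mA; apply/esym.
have -> : leb ((fun x => (x + s)%R) @^-1` A) =
  pushforward leb (fun x : measurableTypeR R => (x + s)%R : measurableTypeR R) A by [].
pose ms := measurable_shift s.
apply: (@lebesgue_measure_unique _ (pushforward leb (fun x : measurableTypeR R => (x + s)%R : measurableTypeR R))) => //= _ [[a b]] _ <-.
rewrite /pushforward /preimage /=.
rewrite preimage_shift_itv !lebesgue_measure_itv/= !lte_fin.
rewrite ltrD2r; case: ifP => // _.
by congr EFin; ring.
Qed.

Lemma ge0_integral_shift (s : R) (D : set R) (f : R -> \bar R) :
  measurable D -> measurable_fun D f -> (forall x, D x -> 0 <= f x) ->
  \int[leb]_(x in (fun x => (x + s)%R) @^-1` D) f (x + s)%R =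
  \int[leb]_(x in D) f x.
Proof.
move=> mD mf f0.
rewrite [RHS](@eq_measure_integral _ _ _ _ (pushforward leb
  (fun x : measurableTypeR R => (x + s)%R : measurableTypeR R))); last first.
  by move=> ? A mA _; exact/esym/lebesgue_measure_shift.
move=> ms; rewrite (ge0_integral_pushforward ms) //.
  by move=> x /[!inE]; exact: f0.
exact: measurable_shift.
Qed.

Lemma ge0_integral_shift_itv (s a b : R) (f : R -> \bar R) :
  measurable_fun setT f -> (forall x, 0 <= f x) ->
  \int[leb]_(x in `[a, b[) f (x + s)%R =
  \int[leb]_(x in `[(a + s)%R, (b + s)%R[) f x.
Proof.
move=> mf f0.
rewrite -(@ge0_integral_shift s `[(a + s)%R, (b + s)%R[) //; last exact: measurable_funTS.
by rewrite /preimage /= preimage_shift_itv !addrK.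
Qed.

(** The restricted measure is concentrated on [D], so that the part of the
integral over the complement of [D] vanishes. *)
Lemma ge0_integral_mrestr (D : set (measurableTypeR R)) (mD : measurable D)
    (f : R -> \bar R) : measurable_fun setT f -> (forall x, 0 <= f x) ->
  \int[mrestr leb mD]_x f x = \int[leb]_(x in D) f x.
Proof.
move=> mf f0.
rewrite (@ge0_negligible_integral _ _ _ (mrestr leb mD) setT (~` D)) //; last 2 first.
- exact: measurableC.
- by rewrite /= /mrestr /= setICl measure0.
rewrite setTD setCK; apply: eq_measure_integral => A mA AD.
by rewrite /= /mrestr setIidl.
Qed.

Lemma ge0_integral_haar (f : R -> \bar R) :
  measurable_fun setT f -> (forall x, 0 <= f x) ->
  \int[haarT R]_x f x = \int[leb]_(x in `[0%R, 1%R[) f x.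
Proof. exact: ge0_integral_mrestr. Qed.

Lemma periodicz (U : Type) (f : R -> U) : (forall x, f (x + 1)%R = f x) ->
  forall (n : int) x, f (x + n%:~R)%R = f x.
Proof.
move=> f1 n x; have fn (k : nat) y : f (y + k%:R)%R = f y.
  by elim: k => [|k IH]; rewrite ?addr0 // -addn1 natrD addrA f1.
by case: n => k; [exact: fn|rewrite NegzE mulrNz -(fn k.+1) subrK].
Qed.

Lemma ge0_integral_itv_cat (a b c : R) (f : R -> \bar R) :
  (a <= b)%R -> (b <= c)%R -> measurable_fun setT f -> (forall x, 0 <= f x) ->
  \int[leb]_(x in `[a, c[) f x =
  \int[leb]_(x in `[a, b[) f x + \int[leb]_(x in `[b, c[) f x.
Proof.
move=> ab bc mf f0.
rewrite -ge0_integral_setU //=; last 2 first.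
- exact: measurable_funTS.
- apply/disj_set2P; rewrite -subset0 => x /= []; rewrite !in_itv/=.
  by move=> /andP[_ xb] /andP[bx _]; move: (lt_le_trans xb bx); rewrite ltxx.
by rewrite -itv_bndbnd_setU ?bnd_simp.
Qed.

(** Invariance of Haar measure: after reducing the shift modulo 1, the circle
is cut in two arcs which are exchanged. *)
Lemma ge0_integral_haar_shift (s : R) (f : R -> \bar R) :
  measurable_fun setT f -> (forall x, 0 <= f x) ->
  (forall x, f (x + 1)%R = f x) ->
  \int[haarT R]_x f (x + s)%R = \int[haarT R]_x f x.
Proof.
move=> mf f0 f1.
have mfs : measurable_fun setT (fun x : R => f (x + s)%R).
  exact: measurableT_comp mf (measurable_shift s).
rewrite !ge0_integral_haar //.
pose r := (s - (Num.floor s)%:~R)%R.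
have r0 : (0 <= r)%R by rewrite subr_ge0 floor_le.
have r1 : (r < 1)%R by have := floorD1_gt s; rewrite intrD /r; lra.
rewrite (eq_integral (fun x : measurableTypeR R => f (x + r)%R)); last first.
  by move=> x _; rewrite /r addrA -mulrNz (periodicz f1).
rewrite ge0_integral_shift_itv // add0r (@ge0_integral_itv_cat r 1 (1 + r)) ?(ltW r1) ?lerDl//.
rewrite [RHS](@ge0_integral_itv_cat 0 r 1) ?(ltW r1)// addeC; congr (_ + _).
rewrite -{1}[1%R]add0r [(1 + r)%R]addrC -ge0_integral_shift_itv //.
by apply: eq_integral => x _; rewrite f1.
Qed.
End Translation.

(** * Averaging operators *)

Section ConvOp.
Variable R : realType.
Local Notation leb := (@lebesgue_measure R).
Local Notation fmeasure := {finite_measure set (measurableTypeR R) -> \bar R}.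
Local Notation H := (haarT R).

Definition arc_measure (a b : R) : set (measurableTypeR R) -> \bar R :=
  mrestr leb (measurable_itv `[a, b[).

HB.instance Definition _ (a b : R) := Measure.on (arc_measure a b).

Lemma arc_measureT (a b : R) : a <= b -> arc_measure a b setT = (b - a)%:E.
Proof.
move=> ab; rewrite /arc_measure /mrestr setTI lebesgue_measure_itv/= lte_fin.
by move: ab; rewrite le_eqVlt => /predU1P[->|->]; rewrite ?ltxx ?subrr// EFinB.
Qed.

Lemma arc_fin_num (a b : R) : fin_num_fun (arc_measure a b).
Proof.
apply: lty_fin_num_fun.
change (arc_measure a b setT < +oo)%E.
rewrite /arc_measure /mrestr setTI lebesgue_measure_itv/=.
by case: ifP => _; rewrite ?ltry.
Qed.

HB.instance Definition _ (a b : R) :=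
  Measure_isFinite.Build _ _ _ (arc_measure a b) (arc_fin_num a b).

Lemma haar_setT : H setT = 1%E.
Proof. by transitivity (arc_measure 0 1 setT) => //; rewrite arc_measureT ?subr0. Qed.

(** Averaging [F] over translations distributed according to [k]. For [F] in L_p
the integral is finite for almost every [x]; [fine] gives a default value elsewhere. *)
Definition conv_op (k : set (measurableTypeR R) -> \bar R) (F : R -> R) (x : R) : R :=
  fine (\int[k]_y (F (x + y))%:E).

Lemma measurable_plus2 : measurable_fun setT (fun z : measurableTypeR R * measurableTypeR R => (z.1 + z.2 : measurableTypeR R)).
Proof. by apply: measurable_funD; [exact: measurable_fst|exact: measurable_snd]. Qed.

Lemma measurable_conv_op (k : fmeasure) (F : R -> R) :
  measurable_fun setT F -> measurable_fun setT (conv_op k F).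
Proof.
move=> mF.
have mF2 : measurable_fun setT (fun z : measurableTypeR R * measurableTypeR R => (F (z.1 + z.2))%:E).
  apply/measurable_EFinP; exact: measurableT_comp mF measurable_plus2.
pose g (z : measurableTypeR R * measurableTypeR R) : \bar R := (F (z.1 + z.2))%:E.
rewrite /conv_op; apply: (measurableT_comp (f := fine)) => //.
under eq_fun do rewrite integralE.
apply: emeasurable_funB.
  have := measurable_fun_fubini_tonelli_F (m2 := k) (g^\+)%E (measurable_funepos mF2) (funepos_ge0 g).
  congr measurable_fun; apply/funext => x.
  by apply: eq_integral => y _; rewrite !funeposE.
have := measurable_fun_fubini_tonelli_F (m2 := k) (g^\-)%E (measurable_funeneg mF2) (funeneg_ge0 g).
congr measurable_fun; apply/funext => x.
by apply: eq_integral => y _; rewrite !funenegE.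
Qed.

(** Exchanging the integrals leaves, for each fixed [y], the Haar integral of a
translate of [f], which does not depend on [y]. *)
Lemma haar_conv_tonelli (k : fmeasure) (f : R -> \bar R) :
  measurable_fun setT f -> (forall x, 0 <= f x)%E -> (forall x, f (x + 1) = f x) ->
  (\int[H]_x \int[k]_y f (x + y)%R = k setT * \int[H]_x f x)%E.
Proof.
move=> mf f0 f1.
have mf2 : measurable_fun setT (fun z : measurableTypeR R * measurableTypeR R => f (z.1 + z.2)).
  exact: measurableT_comp mf measurable_plus2.
transitivity (\int[k]_y \int[H]_x f (x + y)%R)%E.
  exact: (fubini_tonelli (m1 := arc_measure 0 1) (m2 := k)
    (fun z : measurableTypeR R * measurableTypeR R => f (z.1 + z.2)) mf2 (fun=> f0 _)).
rewrite (eq_integral (cst (\int[H]_x f x)%E)) => [|y _]; last exact: ge0_integral_haar_shift.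
by rewrite integral_cst // muleC.
Qed.

End ConvOp.

(** * Averaging operators contract the norm of L_p *)

Section LnormConv.
Variable R : realType.
Local Notation fmeasure := {finite_measure set (measurableTypeR R) -> \bar R}.
Local Notation H := (haarT R).
Local Open Scope ereal_scope.

(** Hoelder's inequality for [g] and the constant function 1. *)
Lemma poweR_integral_le (k : fmeasure) (r : R) (g : R -> R) :
  (1 <= r)%R -> measurable_fun setT g ->
  (\int[k]_y `|(g y)%:E|) `^ r <= k setT `^ (r - 1) * \int[k]_y (`|(g y)%:E| `^ r).
Proof.
rewrite le_eqVlt => /predU1P[<-|r1] mg.
  rewrite subrr poweRe0 mul1e poweRe1; last exact: integral_ge0.
  by under [leRHS]eq_integral do rewrite poweRe1 //.
pose q := (r / (r - 1))%R.
have r0 : (0 < r)%R by lra.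
have rm : (0 < r - 1)%R by lra.
have q0 : (0 < q)%R by rewrite divr_gt0.
have rq : (r^-1 + q^-1 = 1)%R by rewrite /q; field; lra.
have h := hoelder k mg (@measurable_cst _ _ _ _ setT (1 : R)%R) r0 q0 rq.
have {}h : \int[k]_y `|(g y)%:E| <= 'N[k]_r%:E[EFin \o g] * k setT `^ q^-1.
  rewrite -Lnorm_cst1 -Lnorm1; apply: le_trans h.
  by rewrite le_eqVlt; apply/orP; left; apply/eqP/eq_Lnorm => x /=; rewrite mulr1.
apply: (le_trans (gt0_ler_poweR (ltW r0) _ _ h)).
- by rewrite in_itv /= integral_ge0 // leey.
- by rewrite in_itv /= leey andbT mule_ge0 ?Lnorm_ge0 ?poweR_ge0.
rewrite poweRM ?Lnorm_ge0 ?poweR_ge0 // poweR_Lnorm ?gt_eqF // -poweRrM muleC.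
by rewrite (_ : q^-1 * r = r - 1)%R // /q; field; lra.
Qed.

Lemma le_conv_op (k : fmeasure) (F : R -> R) (x : R) : measurable_fun setT F ->
  `|(conv_op k F x)%:E| <= \int[k]_y `|(F (x + y)%R)%:E|.
Proof.
move=> mF.
have mFx : measurable_fun setT (fun y : measurableTypeR R => (F (x + y)%R)%:E).
  apply/measurable_EFinP; apply: measurableT_comp mF _.
  exact: measurable_funD.
apply: (le_trans _ (le_abse_integral k measurableT mFx)).
rewrite /conv_op; case: (\int[k]_y _) => [r| |] //=; first by rewrite leey.
by rewrite leey.
Qed.

(** By [poweR_integral_le] the power [r] of the average at [x] is bounded by an
average of translates of [`|F| `^ r]; integrating over [x], Tonelli's theorem
and invariance of Haar measure remove the average. *)
Lemma Lnorm_conv_op_fin (k : fmeasure) (r : R) (F : R -> R) : (1 <= r)%R ->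
  measurable_fun setT F -> (forall x, F (x + 1)%R = F x) ->
  'N[H]_r%:E[EFin \o conv_op k F] <= k setT * 'N[H]_r%:E[EFin \o F].
Proof.
move=> r1 mF F1; have r0 : (0 < r)%R by lra.
have mpow : measurable_fun setT (fun x : R => `|(F x)%:E| `^ r).
  apply: (measurableT_comp (measurable_poweR _)).
  by apply: measurableT_comp => //; exact/measurable_EFinP.
have kfin : k setT \is a fin_num by exact: fin_num_measure.
(* Hoelder gives the mass to the power [r - 1], Tonelli one more factor. *)
have kr : k setT `^ (r - 1) * k setT = k setT `^ r.
  by rewrite -(fineK kfin) !poweR_EFin -EFinM mulrC mulr_powRB1 // fine_ge0.
have key : \int[H]_x (`|(conv_op k F x)%:E| `^ r) <= k setT `^ r * \int[H]_x (`|(F x)%:E| `^ r).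
  rewrite -kr -muleA -(haar_conv_tonelli k mpow) //; last 2 first.
  - by move=> x; rewrite poweR_ge0.
  - by move=> x; rewrite F1.
  have mG : measurable_fun setT (fun x : R => \int[k]_y (`|(F (x + y)%R)%:E| `^ r)).
    apply: (measurable_fun_fubini_tonelli_F (m2 := k) (fun z : measurableTypeR R * measurableTypeR R =>
      `|(F (z.1 + z.2)%R)%:E| `^ r)) => [|z]; last exact: poweR_ge0.
    exact: measurableT_comp mpow (@measurable_plus2 R).
  rewrite -(fineK kfin) !poweR_EFin -ge0_integralZl_EFin //; last 2 first.
  - by move=> x _; apply: integral_ge0 => y _; exact: poweR_ge0.
  - exact: powR_ge0.
  apply: ge0_le_integral => //.
  - by move=> x _; exact: poweR_ge0.
  - apply: (measurableT_comp (measurable_poweR _)).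
    by apply: measurableT_comp => //; apply/measurable_EFinP; exact: measurable_conv_op.
  - exact: measurable_funeM.
  move=> x _; rewrite -poweR_EFin (fineK kfin).
  have mFx : measurable_fun setT (fun y : R => F (x + y)%R).
    by apply: measurableT_comp mF _; exact: measurable_funD.
  apply: (le_trans _ (poweR_integral_le k r1 mFx)).
  apply: gt0_ler_poweR (le_conv_op k x mF); first exact: ltW.
  - by rewrite in_itv /= leey andbT.
  - by rewrite in_itv /= leey andbT integral_ge0.
rewrite unlock /Lnorm.
apply: (le_trans (gt0_ler_poweR _ _ _ key)).
- by rewrite invr_ge0 ltW.
- by rewrite in_itv /= leey andbT integral_ge0 // => x _; rewrite poweR_ge0.
- by rewrite in_itv /= leey andbT mule_ge0 ?poweR_ge0 // integral_ge0 // => x _; rewrite poweR_ge0.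
rewrite poweRM ?poweR_ge0 //; last by apply: integral_ge0 => x _; rewrite poweR_ge0.
by rewrite -poweRrM mulfV ?gt_eqF // poweRe1.
Qed.

(** The set where [F] exceeds its essential supremum is null. By Tonelli's theorem
almost every translate of it is also null for [k], and at such points the
average obeys the bound. *)
Lemma Lnorm_conv_op_inf (k : fmeasure) (F : R -> R) :
  measurable_fun setT F -> (forall x, F (x + 1)%R = F x) -> 
  'N[H]_+oo[EFin \o F] < +oo ->
  'N[H]_+oo[EFin \o conv_op k F] <= k setT * 'N[H]_+oo[EFin \o F].
Proof.
move=> mF F1.
have NF0 : 0 <= 'N[H]_+oo[EFin \o F] by exact: Lnorm_ge0.
rewrite unlock /Lnorm haar_setT lte01 in NF0 *.
set M := ess_sup H (abse \o (EFin \o F)) in NF0 *; move=> Moo.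
have Mfin : M \is a fin_num by rewrite ge0_fin_numE.
have kfin : k setT \is a fin_num by exact: fin_num_measure.
pose bad : set R := [set x | M < `|(F x)%:E|].
have mbad : measurable bad.
  rewrite -[bad]setTI; apply: measurable_lte => //.
  by apply: measurableT_comp => //; exact/measurable_EFinP.
pose phi (x : R) : \bar R := (\1_bad x)%:E.
have mphi : measurable_fun setT phi by exact/measurable_EFinP/measurable_indic.
have phi0 x : 0 <= phi x by rewrite lee_fin.
have phi1 x : phi (x + 1)%R = phi x.
  rewrite /phi !indicE; congr ((nat_of_bool _)%:R%:E).
  by apply/idP/idP; rewrite !inE /bad /= F1.
have Fbad : \int[H]_x phi x = 0.
  rewrite /phi integral_indic // setIT.
  have : {ae H, forall x, `|(F x)%:E| <= M} by exact: ess_sup_ge.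
  move=> aeM; rewrite -[RHS](_ : H bad = 0) //.
  apply: (measure_negligible (mu := H)) => //; apply: negligibleS aeM => x /= h1 h2.
  by move: h1; rewrite /bad /= ltNge h2.
have := haar_conv_tonelli k mphi phi0 phi1.
rewrite Fbad mule0 => Hk.
apply/ess_supP.
have mG : measurable_fun setT (fun x : R => \int[k]_y phi (x + y)%R).
  apply: (measurable_fun_fubini_tonelli_F (m2 := k) (fun z : measurableTypeR R * measurableTypeR R =>
      phi (z.1 + z.2)%R)) => //.
  exact: measurableT_comp mphi (@measurable_plus2 R).
have {}Hk : \int[H]_x `|\int[k]_y phi (x + y)%R| = 0.
  by rewrite -[RHS]Hk; apply: eq_integral => x _; rewrite gee0_abs // integral_ge0.
have := (ae_eq_integral_abs H measurableT mG).1 Hk.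
apply: filterS => x /(_ Logic.I) /= phix.
apply: (le_trans (le_conv_op k x mF)).
have mFx : measurable_fun setT (fun y : R => (F (x + y)%R)%:E).
  by apply/measurable_EFinP; apply: measurableT_comp mF _; exact: measurable_funD.
have mphix : measurable_fun setT (fun y : R => phi (x + y)%R).
  by apply: measurableT_comp mphi _; exact: measurable_funD.
have {}phix : \int[k]_y `|phi (x + y)%R| = 0.
  by rewrite -[RHS]phix; apply: eq_integral => y _; rewrite gee0_abs.
have {}phix := (ae_eq_integral_abs k measurableT mphix).1 phix.
rewrite muleC -(integral_cst k measurableT M).
apply: ae_ge0_le_integral => //.
- exact: measurableT_comp.
apply: filterS phix => y /(_ Logic.I) /= /eqP.
rewrite /phi eqe indicE pnatr_eq0 eqb0 notin_setE /bad /= => h _.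
by rewrite leNgt; apply/negP.
Qed.

End LnormConv.

(** * Periodic functions in L_p *)

Section TorusLp.
Variable R : realType.
Local Notation fmeasure := {finite_measure set (measurableTypeR R) -> \bar R}.
Local Notation H := (haarT R).

Lemma conv_op_dirac (s : R) (F : R -> R) x : measurable_fun setT F ->
  conv_op (@dirac _ (measurableTypeR R) s R : fmeasure) F x = F (x + s).
Proof.
move=> mF; rewrite /conv_op integral_dirac //; last first.
  by apply/measurable_EFinP; apply: measurableT_comp mF _; exact: measurable_funD.
by rewrite diracT mul1e.
Qed.

Lemma conv_op_shift (k : set (measurableTypeR R) -> \bar R) (F : R -> R) (s x : R) :
  conv_op k (fun x => F (x + s)) x = conv_op k F (x + s).
Proof.
by rewrite /conv_op; congr (fine (integral _ _ _)); apply/funext => y; rewrite addrAC.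
Qed.

Lemma measurable_translate (F : R -> R) x : measurable_fun setT F ->
  measurable_fun setT (fun y : R => (F (x + y))%:E).
Proof.
move=> mF; apply/measurable_EFinP; apply: measurableT_comp mF _.
exact: measurable_funD.
Qed.

Variables (p : \bar R) (p1 : (1 <= p)%E).

(** Functions on the circle are handled as 1-periodic functions on the line, so
that translations need no reduction modulo 1. *)
Definition torus_Lp (F : R -> R) :=
  [/\ measurable_fun setT F, forall x, F (x + 1) = F x &
      ('N[H]_p[EFin \o F] < +oo)%E].

(** Real-valued, so that inequalities between norms can be solved by linear
arithmetic; it is meaningful on [torus_Lp]. *)
Definition Lp_norm (F : R -> R) : R := fine 'N[H]_p[EFin \o F].

Lemma Lp_norm_ge0 F : 0 <= Lp_norm F.
Proof. by rewrite fine_ge0 // Lnorm_ge0. Qed.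

Lemma Lp_norm_cst0 : Lp_norm (fun=> 0 : R) = 0.
Proof.
by rewrite /Lp_norm (_ : EFin \o _ = cst 0%E) // Lnorm0 // gt_eqF // (lt_le_trans _ p1).
Qed.

Lemma Lp_normE F : torus_Lp F -> (Lp_norm F)%:E = 'N[H]_p[EFin \o F]%E.
Proof. by move=> [_ _ h]; rewrite fineK // ge0_fin_numE // Lnorm_ge0. Qed.

Lemma torus_Lp_Lfun F : torus_Lp F -> F \in Lfun H p.
Proof.
move=> [mF _ hF]; rewrite inE; apply/andP; split; rewrite inE //=.
Qed.

Lemma torus_Lp_integrable F : torus_Lp F -> H.-integrable setT (EFin \o F).
Proof.
move=> /torus_Lp_Lfun hF; apply/Lfun1_integrable.
by apply: Lfun_subset hF => //; rewrite haar_setT.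
Qed.

Lemma ae_Lnorm F G : measurable_fun setT F -> measurable_fun setT G ->
  {ae H, forall x, F x = G x} ->
  'N[H]_p[EFin \o F]%E = 'N[H]_p[EFin \o G]%E.
Proof.
move=> mF mG FG.
rewrite unlock /Lnorm; case: p p1 => [r| |] // _; last first.
  case: ifP => // _; apply: eq_ess_sup.
  by apply: (@filterS _ _ (ae_filter_ringOfSetsType H) _ _ _ FG) => x /= ->.
congr poweR; apply: ae_eq_integral => //.
- apply: (measurableT_comp (measurable_poweR _)).
  by apply: measurableT_comp => //; exact/measurable_EFinP.
- apply: (measurableT_comp (measurable_poweR _)).
  by apply: measurableT_comp => //; exact/measurable_EFinP.
- by apply: (@filterS _ _ (ae_filter_ringOfSetsType H) _ _ _ FG) => x /= ->.
Qed.

Lemma ae_Lp_norm F G : torus_Lp F -> torus_Lp G -> {ae H, forall x, F x = G x} ->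
  Lp_norm F = Lp_norm G.
Proof. by move=> [mF _ _] [mG _ _] FG; rewrite /Lp_norm (ae_Lnorm mF mG FG). Qed.

Lemma torus_Lp_conv (k : fmeasure) F : torus_Lp F -> torus_Lp (conv_op k F) /\
  Lp_norm (conv_op k F) <= fine (k setT) * Lp_norm F.
Proof.
move=> TF; have [mF F1 hF] := TF.
have kfin : k setT \is a fin_num by exact: fin_num_measure.
have le : ('N[H]_p[EFin \o conv_op k F] <= (fine (k setT) * Lp_norm F)%:E)%E.
  rewrite EFinM Lp_normE // fineK //.
  case: p p1 hF => [r| |] // r1 hF; first by exact: Lnorm_conv_op_fin.
  exact: Lnorm_conv_op_inf.
have oo := le_lt_trans le (ltry _).
have TkF : torus_Lp (conv_op k F).
  split => //; first exact: measurable_conv_op.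
  by move=> x; rewrite -conv_op_shift; congr conv_op; apply/funext => y.
by split => //; rewrite -lee_fin Lp_normE.
Qed.

(** A translation is the averaging operator of a Dirac mass, hence a
contraction. *)
Lemma torus_Lp_shift F s : torus_Lp F -> torus_Lp (fun x => F (x + s)) /\
  Lp_norm (fun x => F (x + s)) <= Lp_norm F.
Proof.
move=> TF; have [mF _ _] := TF.
have := torus_Lp_conv (@dirac _ (measurableTypeR R) s R : fmeasure) TF.
have -> : conv_op (@dirac _ (measurableTypeR R) s R : fmeasure) F = fun x => F (x + s).
  by apply/funext => x; rewrite conv_op_dirac.
rewrite (_ : fine _ = 1) ?mul1r //.
by rewrite /= /dirac indicT.
Qed.

Lemma torus_LpD F G : torus_Lp F -> torus_Lp G ->
  torus_Lp (fun x => F x + G x) /\ Lp_norm (fun x => F x + G x) <= Lp_norm F + Lp_norm G.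
Proof.
move=> TF TG; have [mF F1 hF] := TF; have [mG G1 hG] := TG.
have h := eminkowski H mF mG p1.
have oo := le_lt_trans h (lte_add_pinfty hF hG).
have T : torus_Lp (fun x => F x + G x).
  by split => //; [exact: measurable_funD|move=> x; rewrite F1 G1].
by split => //; rewrite -lee_fin EFinD !Lp_normE.
Qed.

Lemma torus_LpZ c F : torus_Lp F ->
  torus_Lp (fun x => c * F x) /\ Lp_norm (fun x => c * F x) = `|c| * Lp_norm F.
Proof.
move=> TF; have [mF F1 hF] := TF.
have := LnormZ (Lfun_Sub p1 (torus_Lp_Lfun TF)) c.
rewrite /= (_ : EFin \o (c \*: F) = EFin \o (fun x => c * F x)) // => h.
have T : torus_Lp (fun x => c * F x).
  split; [exact: measurable_funM|by move=> x; rewrite F1|].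
  by rewrite h lte_mul_pinfty // lee_fin.
by split => //; apply: EFin_inj; rewrite EFinM !Lp_normE.
Qed.

Lemma torus_LpB F G : torus_Lp F -> torus_Lp G ->
  torus_Lp (fun x => F x - G x) /\ Lp_norm (fun x => F x - G x) <= Lp_norm F + Lp_norm G.
Proof.
move=> TF TG; have [TN nN] := torus_LpZ (-1) TG.
have [TD nD] := torus_LpD TF TN.
have E : (fun x => F x + -1 * G x) = (fun x => F x - G x).
  by apply/funext => x; rewrite mulN1r.
by rewrite -E; split => //; apply: le_trans nD _; rewrite nN normrN normr1 mul1r.
Qed.

Lemma torus_Lp_sum (I : Type) (s : seq I) (F : I -> R -> R) :
  (forall i, torus_Lp (F i)) ->
  torus_Lp (fun x => \sum_(i <- s) F i x) /\
  Lp_norm (fun x => \sum_(i <- s) F i x) <= \sum_(i <- s) Lp_norm (F i).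
Proof.
move=> TF; elim: s => [|i s [T le]].
  have -> : (fun x => \sum_(i <- [::]) F i x) = cst 0 :> (R -> R).
    by apply/funext => x; rewrite big_nil.
  rewrite big_nil /Lp_norm (_ : EFin \o cst 0 = cst 0%E) // Lnorm0 ?gt_eqF ?(lt_le_trans _ p1) //.
  by split => //; split => //; rewrite (_ : EFin \o cst 0 = cst 0%E) // Lnorm0 ?gt_eqF ?(lt_le_trans _ p1).
have [TD le'] := torus_LpD (TF i) T.
have -> : (fun x => \sum_(j <- i :: s) F j x) = (fun x => F i x + \sum_(j <- s) F j x).
  by apply/funext => x; rewrite big_cons.
by split => //; rewrite big_cons; apply: le_trans le' _; rewrite lerD2l.
Qed.

Lemma haar_conv_integrable (k : fmeasure) F : torus_Lp F ->
  ((arc_measure 0%R 1%R) \x k)%E.-integrable setT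
    (fun z : measurableTypeR R * measurableTypeR R => (F (z.1 + z.2))%:E).
Proof.
move=> TF; have [mF F1 _] := TF.
apply/integrable12ltyP => /=.
  apply/measurable_EFinP; exact: measurableT_comp mF (@measurable_plus2 R).
have mN : measurable_fun setT (fun x : R => `|(F x)%:E|%E).
  by apply: measurableT_comp => //; exact/measurable_EFinP.
rewrite [ltLHS](_ : _ = k setT * \int[H]_x `|(F x)%:E|)%E; last first.
  by rewrite -(haar_conv_tonelli k mN) // => x; rewrite F1.
have /integrableP[_ h] := torus_Lp_integrable TF.
by rewrite lte_mul_pinfty //; exact: fin_num_measure.
Qed.

(** Periodic functions in L_p are integrable over a period. By Tonelli's theorem
[F (x + y)] is then integrable for the product of Haar measure and [k], and
hence, for almost every [x], in [y] alone. The algebraic rules for [conv_op]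
below hold at such points. *)
Lemma ae_conv_integrable (k : fmeasure) F : torus_Lp F ->
  {ae H, forall x, k.-integrable setT (fun y : R => (F (x + y))%:E)}.
Proof. by move=> TF; exact: (ae_integrable1 (haar_conv_integrable k TF)). Qed.

End TorusLp.

(** * Linearity and composition of averaging operators *)

Section ConvAlgebra.
Variable R : realType.
Local Notation fmeasure := {finite_measure set (measurableTypeR R) -> \bar R}.
Local Notation H := (haarT R).
Variables (p : \bar R) (p1 : (1 <= p)%E).

Lemma ae_conv_opB (k : fmeasure) F G : torus_Lp p F -> torus_Lp p G ->
  {ae H, forall x, conv_op k (fun x => F x - G x) x = conv_op k F x - conv_op k G x}.
Proof.
move=> TF TG.
apply: (@filterS2 _ _ (ae_filter_ringOfSetsType H) _ _ _ _
  (ae_conv_integrable p1 k TF) (ae_conv_integrable p1 k TG)) => x iF iG.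
rewrite /conv_op.
under eq_integral do rewrite EFinB.
rewrite integralB // fineB //; exact: integrable_fin_num.
Qed.

Lemma ae_conv_op_measureD (k k1 k2 : fmeasure) (c : R) F : 0 <= c ->
  (forall A, measurable A -> k A = c%:E * k1 A + k2 A)%E -> torus_Lp p F ->
  {ae H, forall x, conv_op k F x = c * conv_op k1 F x + conv_op k2 F x}.
Proof.
move=> c0 kE TF; have [mF _ _] := TF.
apply: (@filterS2 _ _ (ae_filter_ringOfSetsType H) _ _ _ _
  (ae_conv_integrable p1 k1 TF) (ae_conv_integrable p1 k2 TF)) => x i1 i2.
pose g (y : measurableTypeR R) := (F (x + y))%:E.
have mg : measurable_fun setT g by exact: measurable_translate.
pose k1' := mscale (NngNum c0) k1.
have sE f : measurable_fun setT f -> (forall y, 0 <= f y)%E ->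
    (\int[k1']_y f y = c%:E * \int[k1]_y f y)%E.
  by move=> mf f0; rewrite ge0_integral_mscale.
have i1' : k1'.-integrable setT g.
  apply/integrableP; split => //; rewrite sE //; last exact: measurableT_comp.
  by have /integrableP[_ h] := i1; rewrite lte_mul_pinfty.
have s1 : (\int[k1']_y g y = c%:E * \int[k1]_y g y)%E.
  rewrite integralE [in RHS]integralE muleBr //; last first.
    apply: fin_num_adde_defr; exact: integrable_pos_fin_num.
  by rewrite !sE //; [exact: measurable_funeneg|exact: measurable_funepos].
rewrite /conv_op.
rewrite (@eq_measure_integral _ _ _ _ (measure_add k1' k2)); last first.
  move=> A mA _; transitivity (c%:E * k1 A + k2 A)%E; first exact: kE.
  exact/esym/(measure_addE k1' k2 A).
rewrite (@integral_measure_add _ _ _ k1' k2 setT measurableT g) //.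
have f1 := integrable_fin_num measurableT i1.
by rewrite s1 fineD ?fineM // ?fin_numM //; exact: (integrable_fin_num measurableT i2).
Qed.

(** A convolution is the image of a product measure under addition, so the rule
is Fubini's theorem, which applies at the points where [F (x + y)] is
integrable for [k]. *)
Lemma ae_conv_op_comp (k k1 k2 : fmeasure) F : 
  (forall A, measurable A -> k A = (k1 \x k2)%E ((fun z => z.1 + z.2) @^-1` A)) ->
  torus_Lp p F ->
  {ae H, forall x, conv_op k F x = conv_op k1 (conv_op k2 F) x}.
Proof.
move=> kE TF; have [mF _ _] := TF.
pose plus (z : measurableTypeR R * measurableTypeR R) : measurableTypeR R := z.1 + z.2.
apply: (@filterS _ _ (ae_filter_ringOfSetsType H) _ _ _ (ae_conv_integrable p1 k TF)) => x ik.
pose g (y : measurableTypeR R) := (F (x + y))%:E.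
have mg : measurable_fun setT g by exact: measurable_translate.
have kE' A : measurable A -> pushforward (k1 \x k2)%E plus A = k A by move=> mA; rewrite kE.
have mp := @measurable_plus2 R.
have i2 : (k1 \x k2)%E.-integrable setT (g \o plus).
  apply/integrableP; split; first exact: measurableT_comp.
  have /integrableP[_] := ik.
  rewrite (@eq_measure_integral _ _ _ _ (pushforward (k1 \x k2)%E plus)); last first.
    by move=> A mA _; exact/esym/kE'.
  rewrite ge0_integral_pushforward //.
  exact: measurableT_comp.
have E : (\int[k]_y g y = \int[k1]_y \int[k2]_z g (y + z)%R)%E.
  rewrite (@eq_measure_integral _ _ _ _ (pushforward (k1 \x k2)%E plus)); last first.
    by move=> A mA _; exact/esym/kE'.
  rewrite integral_pushforward //.
  by rewrite -(integral12_prod_meas1 i2).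
rewrite /conv_op -/(g _) [X in fine X]E; congr fine.
apply: ae_eq_integral => //.
- exact: (measurable_fubini_F i2).
- exact: (@measurable_translate _ (conv_op k2 F) x (measurable_conv_op k2 mF)).
have := ae_integrable1 i2.
apply: (@filterS _ _ (ae_filter_ringOfSetsType k1)) => y iy _.
rewrite /conv_op fineK.
  by apply: eq_integral => z _; rewrite /g addrA.
have := integrable_fin_num measurableT iy.
by rewrite /= /g /plus /=; under eq_integral do rewrite addrA.
Qed.

Lemma conv_op_arc_shift (a b s x : R) F : measurable_fun setT F ->
  conv_op (arc_measure (a + s) (b + s)) F x = conv_op (arc_measure a b) F (x + s).
Proof.
move=> mF; rewrite /conv_op; congr fine.
have h (f : R -> \bar R) : measurable_fun setT f -> (forall y, 0 <= f y)%E ->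
   (\int[arc_measure (a + s) (b + s)]_y f y = \int[arc_measure a b]_y f (y + s)%R)%E.
  move=> mf f0; rewrite /arc_measure ge0_integral_mrestr //.
  rewrite ge0_integral_mrestr //; first by rewrite ge0_integral_shift_itv.
  by apply: measurableT_comp mf _; exact: measurable_shift.
have mFx : measurable_fun setT (fun y : R => (F (x + y))%:E) by exact: measurable_translate.
rewrite integralE [RHS]integralE !h //; last 2 first.
- exact: measurable_funeneg.
- exact: measurable_funepos.
congr (_ - _)%E; apply: eq_integral => y _; rewrite ?funeposE ?funenegE;
  by rewrite (addrC y) addrA.
Qed.

(** For the full circle the average does not depend on [x], by invariance of
Haar measure applied to the positive and negative parts of [F]. *)
Lemma conv_op_circle (x : R) F : torus_Lp p F ->
  conv_op (arc_measure 0 1) F x = \int[H]_y F y.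
Proof.
move=> [mF F1 _]; rewrite /conv_op /Rintegral; congr fine.
have mF' : measurable_fun setT (fun y : R => (F y)%:E) by exact/measurable_EFinP.
rewrite [LHS]integralE [RHS]integralE.
rewrite -(@ge0_integral_haar_shift _ x (fun y : R => (F y)%:E)^\+%E) //; last 2 first.
- exact: measurable_funepos.
- by move=> y; rewrite !funeposE F1.
rewrite -(@ge0_integral_haar_shift _ x (fun y : R => (F y)%:E)^\-%E) //; last 2 first.
- exact: measurable_funeneg.
- by move=> y; rewrite !funenegE F1.
by congr (_ - _)%E; apply: eq_integral => y _; rewrite ?funeposE ?funenegE addrC.
Qed.

End ConvAlgebra.

(** * A discrete maximum principle *)

(** The second difference of [i * (M - i)] is [-2]. Subtracting [c] times this
function from [u] therefore leaves a convex sequence [w] that is nonpositive at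
both ends of the interval, and such a sequence is nonpositive in between. *)
Lemma discrete_max_principle (R : realFieldType) (M : nat) (u : nat -> R) (c : R) :
  u 0%N <= 0 -> u M <= 0 ->
  (forall i, (i.+1 < M)%N -> u i.+1 <= c + (u i + u i.+2) / 2) ->
  forall i, (i <= M)%N -> u i <= c * (i%:R * (M%:R - i%:R)).
Proof.
move=> u0 uM uc.
pose w i := u i - c * (i%:R * (M%:R - i%:R)).
suff w_le0 i : (i <= M)%N -> w i <= 0 by move=> i /w_le0; rewrite subr_le0.
have convex j : (j.+1 < M)%N -> 2 * w j.+1 <= w j + w j.+2.
  have [e1 e2] : j.+1%:R = j%:R + 1 :> R /\ j.+2%:R = j%:R + 2 :> R.
    by rewrite -natr1 -[j.+2]addn2 natrD.
  move=> /uc; rewrite /w e1 e2; move: (u j) (u j.+1) (u j.+2) (j%:R : R) => x y z t; lra.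
(* Convexity and [w 0 <= 0]: the quotients [w j / j] increase with [j]. *)
have slope j : (j < M)%N -> j.+1%:R * w j <= j%:R * w j.+1.
  elim: j => [|j IH] jM; first by rewrite mul0r mul1r /w mul0r mulr0 subr0.
  have h1 := IH (ltnW jM).
  have h2 := ler_wpM2l (ler0n R j.+1) (convex j jM).
  have [e1 e2] : j.+1%:R = j%:R + 1 :> R /\ j.+2%:R = j%:R + 2 :> R.
    by rewrite -natr1 -[j.+2]addn2 natrD.
  by move: h1 h2; rewrite e1 e2; move: (w j) (w j.+1) (w j.+2) (j%:R : R) => x y z t; lra.
have wM : w M <= 0 by rewrite /w subrr mulr0 mulr0 subr0.
move=> iM; rewrite -(subKn iM); elim: (M - i)%N (leq_subr i M) => [|j IH] jM.
  by rewrite subn0.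
have jM' : (M - j.+1 < M)%N by rewrite ltn_subrL /= (leq_ltn_trans _ jM).
have := slope _ jM'; rewrite subnSK // => h.
have : (M - j)%:R * w (M - j.+1)%N <= 0.
  by apply: le_trans h _; rewrite mulr_ge0_le0 ?ler0n // IH // ltnW.
by rewrite pmulr_rle0 // ltr0n subn_gt0.
Qed.

(** * Difference of two nested measures *)

Section MeasureDifference.
Context d (T : measurableType d) (R : realType).
Variables (k1 k2 : {finite_measure set T -> \bar R}).
Hypothesis k12 : forall A, measurable A -> (k1 A <= k2 A)%E.
Local Open Scope ereal_scope.

(** The absolute value makes the difference nonnegative on nonmeasurable sets
too, as a measure has to be; on measurable sets it changes nothing. The domination
is an argument so that the measure structure can be attached to this function. *)
Definition measure_diff (_ : forall A, measurable A -> (k1 A <= k2 A)%E) (A : set T) := `|k2 A - k1 A|.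

Lemma measure_diffE A : measurable A -> k2 A = k1 A + measure_diff k12 A.
Proof.
move=> mA; have f1 := fin_num_measure k1 A mA; have f2 := fin_num_measure k2 A mA.
by rewrite /measure_diff gee0_abs ?sube_ge0 ?k12 // ?f2 ?orbT // addeC subeK.
Qed.

Let measure_diff0 : measure_diff k12 set0 = 0.
Proof. by rewrite /measure_diff !measure0 subee // abse0. Qed.

Let measure_diff_ge0 A : 0 <= measure_diff k12 A.
Proof. exact: abse_ge0. Qed.

Let measure_diff_sigma_additive : semi_sigma_additive (measure_diff k12).
Proof.
move=> F mF tF mU.
have f1 A := fin_num_measure k1 A; have f2 A := fin_num_measure k2 A.
have mE A : measurable A -> measure_diff k12 A = k2 A - k1 A.
  by move=> mA; rewrite (measure_diffE mA) addeAC subee ?add0e // f1.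
rewrite mE //.
under eq_fun do under eq_bigr do rewrite mE //.
have -> : (fun n => \sum_(0 <= i < n) (k2 (F i) - k1 (F i))) =
  (fun n => \sum_(0 <= i < n) k2 (F i) - \sum_(0 <= i < n) k1 (F i)).
  apply/funext => n; rewrite big_split /= -sumeN // => i j _ _.
  by rewrite fin_num_adde_defr // f1.
apply: cvgeB; [|exact: measure_semi_sigma_additive..].
by rewrite fin_num_adde_defr // f2.
Qed.

HB.instance Definition _ := isMeasure.Build _ _ _ (measure_diff k12)
  measure_diff0 measure_diff_ge0 measure_diff_sigma_additive.

Let measure_diff_fin_num : fin_num_fun (measure_diff k12).
Proof. by move=> A mA; rewrite /measure_diff abse_fin_num fin_numB !fin_num_measure. Qed.

HB.instance Definition _ := Measure_isFinite.Build _ _ _ (measure_diff k12) measure_diff_fin_num.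

End MeasureDifference.

(** * Spectral gap for kernels that dominate an arc *)

Section SpectralGap.
Variable R : realType.
Local Notation fmeasure := {finite_measure set (measurableTypeR R) -> \bar R}.
Local Notation H := (haarT R).
Local Notation aeT := (ae_filter_ringOfSetsType H).
Variables (p : \bar R) (p1 : (1 <= p)%E).

Lemma arc_measure_cat (a b c : R) (A : set R) : a <= b -> b <= c -> measurable A ->
  (arc_measure a c A = arc_measure a b A + arc_measure b c A)%E.
Proof.
move=> ab bc mA.
rewrite /arc_measure /mrestr (@itv_bndbnd_setU _ _ _ (BLeft b)) ?bnd_simp// setIUr measureU //.
- by apply: measurableI => //; exact: measurable_itv.
- by apply: measurableI => //; exact: measurable_itv.
rewrite -subset0 => x /= [[_ +] [_]]; rewrite !in_itv/=.
by move=> /andP[_ xb] /andP[bx _]; move: (lt_le_trans xb bx); rewrite ltxx.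
Qed.

Lemma ae_conv_op_arc_cat (a b c : R) F : a <= b -> b <= c -> torus_Lp p F ->
  {ae H, forall x, conv_op (arc_measure a c) F x =
    conv_op (arc_measure a b) F x + conv_op (arc_measure b c) F x}.
Proof.
move=> ab bc TF.
have E A : measurable A ->
    (arc_measure a c A = 1%:E * arc_measure a b A + arc_measure b c A)%E.
  by move=> mA; rewrite mul1e; exact: arc_measure_cat.
apply: (@filterS _ _ aeT _ _ _ (ae_conv_op_measureD p1 ler01 E TF)) => x.
by rewrite mul1r.
Qed.

Variables (F : R -> R) (TF : torus_Lp p F).
Variable (M : nat).
Hypothesis M0 : (0 < M)%N.
Variable w : R.
Hypothesis Mw : M%:R * w = 1.
Let W G := conv_op (arc_measure 0 w) G : R -> R.
Let d (i : nat) (x : R) := F (x + i%:R * w) - F x.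
Let u i := Lp_norm p (d i).

Let mF : measurable_fun setT F. Proof. by case: TF. Qed.
Let w0 : 0 < w. Proof. by rewrite -(pmulr_rgt0 _ (_ : 0 < M%:R :> R)) ?ltr0n // Mw. Qed.

Let Td i : torus_Lp p (d i).
Proof. exact: (torus_LpB p1 (torus_Lp_shift p1 (i%:R * w) TF).1 TF).1. Qed.

Let arcT : fine (arc_measure 0 w setT) = w.
Proof. by rewrite arc_measureT ?subr0 // ltW. Qed.

Let W_shift s G : measurable_fun setT G ->
  conv_op (arc_measure s (s + w)) G = (fun x => W G (x + s)).
Proof.
move=> mG; apply/funext => x; rewrite /W -conv_op_arc_shift // add0r.
by rewrite addrC.
Qed.

Let Wd s i : {ae H, forall x, W (d i) (x + s) = W F (x + (s + i%:R * w)) - W F (x + s)}.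
Proof.
have T1 := (torus_Lp_shift p1 (s + i%:R * w) TF).1.
have T2 := (torus_Lp_shift p1 s TF).1.
apply: (@filterS _ _ aeT _ _ _ (ae_conv_opB p1 (arc_measure 0 w) T1 T2)) => x.
rewrite /W -!conv_op_shift => <-.
by congr conv_op; apply/funext => y; rewrite /d -addrA.
Qed.

Let Lp_normW G : torus_Lp p G -> torus_Lp p (W G) /\ Lp_norm p (W G) <= w * Lp_norm p G.
Proof.
by move=> TG; have := torus_Lp_conv p1 (arc_measure 0 w) TG; rewrite [fine _]arcT.
Qed.

Let Lp_normWs G s : torus_Lp p G ->
  torus_Lp p (fun x => W G (x + s)) /\ Lp_norm p (fun x => W G (x + s)) <= w * Lp_norm p G.
Proof.
move=> TG; have [TW le] := Lp_normW TG.
have [Ts les] := torus_Lp_shift p1 s TW.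
by split => //; exact: le_trans les le.
Qed.

Let u0 : u 0 = 0.
Proof.
rewrite /u (_ : d 0 = fun=> 0) ?(Lp_norm_cst0 p1) //.
by apply/funext => x; rewrite /d mul0r addr0 subrr.
Qed.

Let uM : u M = 0.
Proof.
have [_ F1 _] := TF.
rewrite /u (_ : d M = fun=> 0) ?(Lp_norm_cst0 p1) //.
by apply/funext => x; rewrite /d Mw F1 subrr.
Qed.

Let W_sum : {ae H, forall x, conv_op (arc_measure 0 1) F x = \sum_(i < M) W F (x + i%:R * w)}.
Proof.
have h n : {ae H, forall x, conv_op (arc_measure 0 (n.+1%:R * w)) F x =
    \sum_(i < n.+1) W F (x + i%:R * w)}.
  elim: n => [|n IH].
    by apply: aeW => x; rewrite big_ord1 mul0r addr0 mul1r.
  have le1 : 0 <= n.+1%:R * w by rewrite mulr_ge0 // ltW.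
  have le2 : n.+1%:R * w <= n.+2%:R * w by rewrite ler_pM2r // ler_nat.
  apply: (@filterS2 _ _ aeT _ _ _ _ IH (ae_conv_op_arc_cat le1 le2 TF)) => x e ->.
  rewrite big_ord_recr /= e; congr (_ + _).
  have -> : n.+2%:R * w = n.+1%:R * w + w by rewrite -[n.+2%:R]natr1 mulrDl mul1r.
  by rewrite W_shift.
by have := h M.-1; rewrite (prednK M0) Mw.
Qed.

(** The [M] translates of [W F] by multiples of [w] add up to the integral of
[F] over the circle, which is 0. Hence [W F] is, up to sign, [w] times the sum
of its increments [W (d i)], and each of them has norm at most [w * u i]. *)
Let Lp_norm_W_le (B : R) : \int[H]_x F x = 0 -> (forall i, (i <= M)%N -> u i <= B) -> Lp_norm p (W F) <= w * B.
Proof.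
move=> F0 uB.
have aed : {ae H, forall x i, W (d i) (x + 0) = W F (x + (0 + i%:R * w)) - W F (x + 0)}.
  by apply/ae_foralln => i; exact: Wd.
have [TS leS] := torus_Lp_sum p1 (index_enum 'I_M) (fun i => (Lp_normW (Td i)).1).
have [TZ nZ] := torus_LpZ p1 (- w) TS.
rewrite (ae_Lp_norm p1 (Lp_normW TF).1 TZ); last first.
  apply: (@filterS2 _ _ aeT _ _ _ _ aed W_sum) => x e.
  rewrite (conv_op_circle x TF) F0 => s.
  under eq_bigr do rewrite -[x in W _ x]addr0 e add0r addr0.
  rewrite sumrB -s sub0r sumr_const card_ord mulrN mulNr opprK -mulr_natl mulrA.
  by rewrite (mulrC w) Mw mul1r.
rewrite nZ normrN gtr0_norm // ler_pM2l //.
apply: (le_trans leS).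
apply: (@le_trans _ _ (\sum_(i < M) w * B)).
  apply: ler_sum => i _; apply: (le_trans (Lp_normW (Td i)).2).
  by rewrite ler_pM2l // uB // ltnW.
by rewrite sumr_const card_ord -mulr_natl mulrA Mw mul1r.
Qed.

Section Gap.
Variables (k : fmeasure) (a beta : R).
Hypothesis k1 : k setT = 1%E.
Hypothesis beta0 : 0 < beta.
Hypothesis k_ge : forall A, measurable A ->
  (beta%:E * arc_measure (a - w) (a + w) A <= k A)%E.

Let karc : fmeasure := mscale (NngNum (ltW beta0)) (arc_measure (a - w) (a + w)).
Let k_ge' A : measurable A -> (karc A <= k A)%E.
Proof. exact: k_ge. Qed.
Let nu : fmeasure := measure_diff k_ge'.

Let kE A : measurable A ->
  (k A = beta%:E * arc_measure (a - w) (a + w) A + nu A)%E.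
Proof. by move=> mA; rewrite (measure_diffE k_ge' mA). Qed.

Let nuT : fine (nu setT) = 1 - 2 * w * beta.
Proof.
have := kE measurableT; rewrite k1 arc_measureT; last first.
  by have := w0; lra.
have : nu setT \is a fin_num by exact: fin_num_measure.
by case: (nu setT) => //= r _; rewrite -EFinM -EFinD => -[]; lra.
Qed.

Let ae_k G : torus_Lp p G -> {ae H, forall x, conv_op k G x =
  beta * (W G (x + (a - w)) + W G (x + a)) + conv_op nu G x}.
Proof.
move=> TG; have [mG _ _] := TG.
have e1 := W_shift (a - w) mG; rewrite subrK in e1.
have le1 : a - w <= a by rewrite gerBl ltW.
have le2 : a <= a + w by rewrite lerDl ltW.
apply: (@filterS2 _ _ aeT _ _ _ _ (ae_conv_op_arc_cat le1 le2 TG)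
   (ae_conv_op_measureD p1 (ltW beta0) kE TG)) => x e ->.
by rewrite e e1 (W_shift a mG).
Qed.

Let Lp_norm_nu G : torus_Lp p G ->
  torus_Lp p (conv_op nu G) /\ Lp_norm p (conv_op nu G) <= (1 - 2 * w * beta) * Lp_norm p G.
Proof. by move=> TG; rewrite -nuT; exact: torus_Lp_conv. Qed.

Let g x := F x - conv_op k F x.
Let eta := Lp_norm p g.

Let Tk G : torus_Lp p G -> torus_Lp p (conv_op k G).
Proof. by move=> TG; exact: (torus_Lp_conv p1 k TG).1. Qed.

Let Tg : torus_Lp p g.
Proof. exact: (torus_LpB p1 TF (Tk TF)).1. Qed.

Let ae_dk i : {ae H, forall x, d i x - conv_op k (d i) x = g (x + i%:R * w) - g x}.
Proof.
have Ts := (torus_Lp_shift p1 (i%:R * w) TF).1.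
apply: (@filterS _ _ aeT _ _ _ (ae_conv_opB p1 k Ts TF)) => x.
rewrite conv_op_shift => e; rewrite [conv_op k (d i) x]e /g /d; ring.
Qed.

(** The arc of [k] consists of two halves of length [w], starting at [a - w] and
at [a]. In the average of [d i.+1] over the arc, the two copies of [F] at
distance [i.+1] see these halves; if they use them in opposite order, the
sum of the two increments at distance [i.+1] becomes the sum of one increment
at distance [i] and one at distance [i.+2]. The rest [nu] of the kernel has mass
[1 - 2 * w * beta] and contracts [d i.+1] itself, so that [u i.+1] can be
absorbed into the left-hand side. *)
Let u_rec i : u i.+1 <= eta / (w * beta) + (u i + u i.+2) / 2.
Proof.
have [Tgs les] := torus_Lp_shift p1 (i.+1%:R * w) Tg.
have [Tgg leg] := torus_LpB p1 Tgs Tg.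
have [T1 le1] := Lp_normWs (a - w) (Td i.+2).
have [T2 le2] := Lp_normWs a (Td i).
have [T12 le12] := torus_LpD p1 T1 T2.
have [Tb nb] := torus_LpZ p1 beta T12.
have [Tn len] := Lp_norm_nu (Td i.+1).
have [Tr ler] := torus_LpD p1 Tb Tn.
have [Tt let_] := torus_LpD p1 Tgg Tr.
have e : Lp_norm p (d i.+1) <= 2 * eta + (beta * (w * u i.+2 + w * u i) + (1 - 2 * w * beta) * u i.+1).
  rewrite (ae_Lp_norm p1 (Td i.+1) Tt).
    apply: (le_trans let_); apply: lerD.
      by apply: (le_trans leg); rewrite mulrDl !mul1r lerD.
    apply: (le_trans ler); apply: lerD => //.
    rewrite nb gtr0_norm // ler_pM2l //.
    by apply: (le_trans le12); apply: lerD.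
  have aeW1 := Wd (a - w) i.+1.
  have aeW2 := Wd a i.+1.
  have aeW3 := Wd (a - w) i.+2.
  have aeW4 := Wd a i.
  have ae12 := @filterS2 _ _ aeT _ _ _ (fun x => @conj _ _) (ae_dk i.+1) (ae_k (Td i.+1)).
  have aeA := @filterS2 _ _ aeT _ _ _ (fun x => @conj _ _) aeW1 aeW2.
  have aeB := @filterS2 _ _ aeT _ _ _ (fun x => @conj _ _) aeW3 aeW4.
  apply: (@filterS3 _ _ aeT _ _ _ _ _ ae12 aeA aeB) => x [e1 e2] [e3 e4] [e5 e6].
  (* The exchange of the two halves: both sides expand to the same four values
     of [W F]. *)
  have -> : W (d i.+2) (x + (a - w)) + W (d i) (x + a) =
            W (d i.+1) (x + (a - w)) + W (d i.+1) (x + a).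
    rewrite e3 e4 e5 e6.
    have -> : a - w + i.+2%:R * w = a + i.+1%:R * w by rewrite -(natr1 i.+1); ring.
    have -> : a - w + i.+1%:R * w = a + i%:R * w by rewrite -(natr1 i); ring.
    by ring.
  by rewrite -e1 -e2; ring.
have wb : 0 < w * beta by rewrite mulr_gt0.
rewrite -(ler_pM2l wb) mulrDr mulrCA mulfV ?gt_eqF // mulr1.
move: e; rewrite -/(u i.+1); move: (u i) (u i.+1) (u i.+2) eta => x y z t; lra.
Qed.

(** The function [F] is close to its average under [k], and the part of this
average over the arc is a combination of translates of [W F]. These are
controlled by the numbers [u i] ([Lp_norm_W_le]), which the maximum principle
bounds, because [u 0 = u M = 0] by periodicity and [u_rec] holds in between. *)
Lemma spectral_gap_arc : \int[H]_x F x = 0 ->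
  Lp_norm p F <= (M%:R / beta + M%:R ^+ 3 / beta) * Lp_norm p (fun x => F x - conv_op k F x).
Proof.
move=> F0; rewrite -/g -/eta.
have eta0 : 0 <= eta by exact: Lp_norm_ge0.
have wb : 0 < w * beta by rewrite mulr_gt0.
have c0 : 0 <= eta / (w * beta) by rewrite divr_ge0 // ltW.
have uB i : (i <= M)%N -> u i <= eta / (w * beta) * M%:R ^+ 2.
  move=> iM; apply: (le_trans (discrete_max_principle _ _ (fun i _ => u_rec i) iM)).
  - by rewrite u0.
  - by rewrite uM.
  have i0 := ler0n R i; have iM' : i%:R <= M%:R :> R by rewrite ler_nat.
  by rewrite ler_wpM2l //; nra.
have WB := Lp_norm_W_le F0 uB.
have [T1 le1] := torus_LpD p1 (torus_Lp_shift p1 (a - w) (Lp_normW TF).1).1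
   (torus_Lp_shift p1 a (Lp_normW TF).1).1.
have [Tb nb] := torus_LpZ p1 beta T1.
have [Tn len] := Lp_norm_nu TF.
have [Tr ler] := torus_LpD p1 Tb Tn.
have [Tt let_] := torus_LpD p1 Tg Tr.
have e : Lp_norm p F <= eta + (beta * (Lp_norm p (W F) + Lp_norm p (W F)) + (1 - 2 * w * beta) * Lp_norm p F).
  rewrite {1}(ae_Lp_norm p1 TF Tt); last first.
    by apply: (@filterS _ _ aeT _ _ _ (ae_k TF)) => x <-; rewrite /g subrK.
  apply: (le_trans let_); rewrite lerD2l; apply: (le_trans ler); apply: lerD => //.
  rewrite nb gtr0_norm // ler_pM2l //; apply: (le_trans le1).
  by apply: lerD; exact: (torus_Lp_shift p1 _ (Lp_normW TF).1).2.
have M1 : 1 <= M%:R :> R by rewrite ler1n.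
have {}e : w * beta * Lp_norm p F <= eta + w * beta * (eta / (w * beta) * M%:R ^+ 2).
  have := ler_wpM2l (ltW beta0) WB.
  by move: e eta0; move: (Lp_norm p F) (Lp_norm p (W F)) (eta / (w * beta) * M%:R ^+ 2) eta => x y q z; lra.
rewrite (_ : w * beta * (eta / (w * beta) * M%:R ^+ 2) = eta * M%:R ^+ 2) in e; last first.
  by field; rewrite !gt_eqF.
rewrite -(ler_pM2l wb); apply: (le_trans e).
rewrite le_eqVlt; apply/orP; left; apply/eqP.
rewrite (_ : w = M%:R^-1); last by apply: (mulfI (x := M%:R)); rewrite ?Mw ?mulfV // pnatr_eq0 gtn_eqF.
by field; rewrite gt_eqF //= pnatr_eq0 gtn_eqF.
Qed.

End Gap.
End SpectralGap.

(** * The defect of a kernel *)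

Section Defect.
Variable R : realType.
Local Notation fmeasure := {finite_measure set (measurableTypeR R) -> \bar R}.
Local Notation H := (haarT R).
Local Notation aeT := (ae_filter_ringOfSetsType H).
Variables (p : \bar R) (p1 : (1 <= p)%E).

Definition defect (k : set (measurableTypeR R) -> \bar R) (F : R -> R) : R :=
  Lp_norm p (fun x => F x - conv_op k F x).

(** Writing [A1], [A2] for the averaging operators of [k1], [k2], one has
[F - A1 (A2 F) = (F - A1 F) + A1 (F - A2 F)], and [A1] is a contraction. *)
Lemma defect_convolution (k k1 k2 : fmeasure) F :
  (forall A, measurable A -> k A = (k1 \x k2)%E ((fun z => z.1 + z.2) @^-1` A)) ->
  k1 setT = 1%E -> torus_Lp p F ->
  defect k F <= defect k1 F + defect k2 F.
Proof.
move=> kE k1T TF.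
have Tk := (torus_Lp_conv p1 k TF).1.
have Tk1 := (torus_Lp_conv p1 k1 TF).1.
have Tk2 := (torus_Lp_conv p1 k2 TF).1.
have [TD1 _] := torus_LpB p1 TF Tk1.
have [TD2 _] := torus_LpB p1 TF Tk2.
have [TD3 le3] := torus_Lp_conv p1 k1 TD2.
have [TD le] := torus_LpD p1 TD1 TD3.
rewrite /defect (ae_Lp_norm p1 (torus_LpB p1 TF Tk).1 TD); last first.
  apply: (@filterS2 _ _ aeT _ _ _ _ (ae_conv_op_comp p1 kE TF) (ae_conv_opB p1 k1 TF Tk2)).
  by move=> x -> ->; rewrite addrA subrK.
apply: (le_trans le); rewrite lerD2l; apply: (le_trans le3).
by rewrite [X in fine X]k1T mul1r.
Qed.

Lemma eq_conv_op (k k' : fmeasure) (F : R -> R) :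
  (forall A, measurable A -> k A = k' A) -> conv_op k F = conv_op k' F.
Proof.
move=> kk; apply/funext => x; rewrite /conv_op; congr fine.
by apply: eq_measure_integral => A mA _; exact: kk.
Qed.

End Defect.

(** * Laws and partial sums of independent variables *)

Section Law.
Context d (T : measurableType d) (R : realType) (Q : probability T R).
Variable X : {RV Q >-> R}.

(** The law of a random variable, carried by the same measurable structure as
Lebesgue measure. *)
Definition law : set (measurableTypeR R) -> \bar R := distribution Q X.

Let law0 : law set0 = 0%E.
Proof. exact: measure0. Qed.

Let law_ge0 A : (0 <= law A)%E.
Proof. exact: measure_ge0. Qed.

Let law_sigma_additive : semi_sigma_additive law.
Proof. exact: (@measure_semi_sigma_additive _ _ _ (distribution Q X)). Qed.

HB.instance Definition _ := isMeasure.Build _ _ _ law law0 law_ge0 law_sigma_additive.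

Let law_setT : law setT = 1%E.
Proof. exact: (@probability_setT _ _ _ (distribution Q X)). Qed.

HB.instance Definition _ := Measure_isProbability.Build _ _ _ law law_setT.

Lemma measurable_RV : measurable_fun setT (X : T -> measurableTypeR R).
Proof. exact: (measurable_funPT X). Qed.

Lemma ge0_integral_law (f : R -> \bar R) : measurable_fun setT f -> (forall y, 0 <= f y)%E ->
  (\int[law]_y f y = \int[Q]_w f (X w))%E.
Proof.
move=> mf f0.
exact: (ge0_integral_pushforward measurable_RV Q measurableT mf (fun y _ => f0 y)).
Qed.

End Law.

Section IndependentSums.
Context d (T : measurableType d) (R : realType) (Q : probability T R).
Variables (n : nat) (X : 'I_n -> {RV Q >-> R}).
Hypothesis indepX : mutually_independent X.
Local Open Scope ereal_scope.

Definition psum (j : nat) (w : T) : R := (\sum_(i < n | (i < j)%N) X i w)%R.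

Lemma measurable_psum j : measurable_fun setT (psum j).
Proof.
rewrite /psum; under eq_fun do rewrite big_mkcond.
apply: measurable_sum => i; case: (i < j)%N => //.
Qed.

HB.instance Definition _ j := isMeasurableFun.Build _ _ _ _ (psum j) (measurable_psum j).

Definition later_event (j : nat) (B : 'I_n -> set R) : set T :=
  \bigcap_(i in [set i : 'I_n | (j <= i)%N]) (X i @^-1` B i).

Definition later_prob (j : nat) (B : 'I_n -> set R) : \bar R :=
  \prod_(i < n | (j <= i)%N) Q (X i @^-1` B i).

Local Notation law f := (@law _ _ _ Q f).

Lemma measurable_later_event j B : (forall i, measurable (B i)) -> measurable (later_event j B).
Proof.
move=> mB; apply: fin_bigcap_measurable; first exact: finite_finset.
by move=> i _; rewrite -[X in measurable X]setTI; exact: measurable_funP.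
Qed.

Lemma later_prob_fin j B : (forall i, measurable (B i)) -> later_prob j B \is a fin_num.
Proof.
move=> mB; apply: (big_ind (fun x => x \is a fin_num)) => //; first by move=> x y; exact: fin_numM.
move=> i _; apply: fin_num_measure.
by rewrite -[X in measurable X]setTI; exact: measurable_funP.
Qed.

Lemma later_prob_ge0 j B : 0 <= later_prob j B.
Proof. by apply: prode_ge0. Qed.

Lemma psumS (j : 'I_n) w : (psum j.+1 w = psum j w + X j w)%R.
Proof.
rewrite /psum (bigD1 j) //= addrC; congr (_ + _)%R.
apply: eq_bigl => i; rewrite ltnS [RHS]ltn_neqAle andbC; congr (~~ _ && _).
Qed.

(** With the later event kept fixed, both sides are finite measures of the planar
set of pairs with sum in [A]. They agree on rectangles by hypothesis, hence on
all measurable sets. *)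
Lemma psumS_law_aux (j : 'I_n) B : (forall i, measurable (B i)) ->
  (forall A D, measurable A -> measurable D ->
    Q (psum j @^-1` A `&` X j @^-1` D `&` later_event j.+1 B) =
    Q (psum j @^-1` A) * Q (X j @^-1` D) * later_prob j.+1 B) ->
  forall A, measurable A ->
   Q (psum j.+1 @^-1` A `&` later_event j.+1 B) =
   later_prob j.+1 B * (law (psum j) \x law (X j)) ((fun z => z.1 + z.2)%R @^-1` A).
Proof.
move=> mB rect A mA.
pose q := fine (later_prob j.+1 B).
have qE : q%:E = later_prob j.+1 B by rewrite fineK // later_prob_fin.
have q0 : (0 <= q)%R by rewrite fine_ge0 // later_prob_ge0.
pose E := later_event j.+1 B.
have mE : measurable E by exact: measurable_later_event.
pose pair (w : T) : measurableTypeR R * measurableTypeR R := (psum j w, X j w).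
have mpair : measurable_fun setT pair.
  exact: (measurable_fun_pair (measurable_RV (psum j)) (measurable_RV (X j))).
pose m' := [the {measure set (measurableTypeR R * measurableTypeR R)%type -> \bar R} of pushforward (mrestr Q mE) pair].
pose m1 := [the {finite_measure set (measurableTypeR R) -> \bar R} of mscale (NngNum q0) (law (psum j))].
pose m'' := [the {measure set (measurableTypeR R * measurableTypeR R)%type -> \bar R} of mscale (NngNum q0) (law (psum j) \x law (X j))].
have mplus : measurable ((fun z : measurableTypeR R * measurableTypeR R => z.1 + z.2)%R @^-1` A).
  by rewrite -[X in measurable X]setTI; exact: (@measurable_plus2 R).
have <- : m' mpair ((fun z => z.1 + z.2)%R @^-1` A) = Q (psum j.+1 @^-1` A `&` E).
  rewrite /m' /pushforward /mrestr; congr (Q (_ `&` _)).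
  by apply/seteqP; split => w /=; rewrite psumS.
rewrite -qE.
have <- : m'' ((fun z => z.1 + z.2)%R @^-1` A) = q%:E * (law (psum j) \x law (X j)) ((fun z => z.1 + z.2)%R @^-1` A) by [].
rewrite -(@product_measure_unique _ _ _ _ _ m1 (law (X j)) (m' mpair)) //; last first.
  move=> A' D mA' mD.
  transitivity (Q (psum j @^-1` A' `&` X j @^-1` D `&` E)) => //.
  by rewrite rect // -qE muleC muleA.
rewrite -(@product_measure_unique _ _ _ _ _ m1 (law (X j)) m'') //.
move=> A' D mA' mD.
transitivity (q%:E * (law (psum j) \x law (X j)) (A' `*` D)) => //.
transitivity (q%:E * law (psum j) A' * law (X j) D) => //.
by rewrite -muleA; congr (_ * _); exact: product_measure1E.
Qed.

(** The event on the later variables is what makes this property pass from [j]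
to [j.+1]: the next summand is taken out of it. *)
Definition later_indep (j : nat) := forall B A,
  (forall i, measurable (B i)) -> measurable A ->
  Q (psum j @^-1` A `&` later_event j B) = Q (psum j @^-1` A) * later_prob j B.

(** The hypothesis is used with [B j] replaced by [D]. *)
Lemma later_indep_rect (j : 'I_n) B A D : later_indep j ->
  (forall i, measurable (B i)) -> measurable A -> measurable D ->
  Q (psum j @^-1` A `&` X j @^-1` D `&` later_event j.+1 B) =
  Q (psum j @^-1` A) * Q (X j @^-1` D) * later_prob j.+1 B.
Proof.
move=> IH mB mA mD.
pose B' i := if i == j then D else B i.
have mB' i : measurable (B' i) by rewrite /B'; case: ifP.
have := IH B' A mB' mA.
have -> : later_event j B' = X j @^-1` D `&` later_event j.+1 B.
  apply/seteqP; split => w /=.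
    move=> h; split; first by have := h j (leqnn _); rewrite /B' eqxx.
    move=> i /= ij; have := h i (ltnW ij); rewrite /B'.
    by case: eqP => // e; move: ij; rewrite e ltnn.
  move=> [h1 h2] i /= ij; rewrite /B'; case: eqP => [->//|/eqP ne].
  by apply: h2; rewrite /= ltn_neqAle ij andbT eq_sym.
have -> : later_prob j B' = Q (X j @^-1` D) * later_prob j.+1 B.
  rewrite /later_prob (bigD1 j) //= /B' eqxx; congr (_ * _).
  apply: eq_big => [i|i /andP[_ /negbTE ->]//].
  by rewrite [RHS]ltn_neqAle andbC eq_sym.
by rewrite setIA muleA.
Qed.

Lemma psumS_law (j : 'I_n) A : later_indep j -> measurable A ->
  law (psum j.+1) A = (law (psum j) \x law (X j)) ((fun z => z.1 + z.2)%R @^-1` A).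
Proof.
move=> IH mA; have mT (i : 'I_n) : measurable ((fun=> setT : set R) i) by [].
have := psumS_law_aux (j := j) mT (fun A D => later_indep_rect IH mT) mA.
have -> : later_event j.+1 (fun=> setT) = setT by apply/seteqP; split.
have -> : later_prob j.+1 (fun=> setT) = 1.
  by rewrite /later_prob big1 // => i _; rewrite preimage_setT probability_setT.
by rewrite setIT mul1e.
Qed.

Lemma psum_later_indep j : (j <= n)%N -> later_indep j.
Proof.
elim: j => [|j IH] jn B A mB mA.
  have S0 w : psum 0 w = 0%R by rewrite /psum big_pred0.
  have [A0|A0] := pselect (A 0%R).
    rewrite (_ : psum 0 @^-1` A = setT); last by apply/seteqP; split => w //= _; rewrite S0.
    rewrite setTI probability_setT mul1e /later_event /later_prob.
    rewrite (_ : [set i : 'I_n | _] = setT); last by apply/seteqP; split.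
    exact: indepX.
  rewrite (_ : psum 0 @^-1` A = set0); last by apply/seteqP; split => w //=; rewrite S0.
  by rewrite set0I measure0 mul0e.
have {}IH := IH (ltnW jn).
have := psumS_law_aux (j := Ordinal jn) mB (fun A D => @later_indep_rect (Ordinal jn) B A D IH mB) mA.
by move=> /= ->; rewrite -(@psumS_law (Ordinal jn)) // muleC.
Qed.

End IndependentSums.

(** * Absolutely continuous part *)

Section AcPart.
Variable R : realType.
Local Notation leb := (@lebesgue_measure R).
Local Notation fmeasure := {finite_measure set (measurableTypeR R) -> \bar R}.
Local Open Scope ereal_scope.

(** The density of the absolutely continuous part is positive on a set of positive
measure, hence at least [1 / (n + 1)] on a set of positive measure for some [n]. *)
Lemma ac_part_minorant (rho : set (measurableTypeR R) -> \bar R) :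
  (rho setT < +oo) -> has_ac_part rho ->
  exists E : set (measurableTypeR R), exists e : R,
   [/\ measurable E, 0 < leb E, (0 < e)%R &
    forall A, measurable A -> e%:E * leb (A `&` E) <= rho A].
Proof.
move=> rhoT [mua [mus [rhoE dom sing mua0]]].
have muaT : mua setT < +oo.
  apply: le_lt_trans rhoT; rewrite rhoE // leeDl //.
pose m : fmeasure := mfrestr measurableT muaT.
have mE A : m A = mua A by rewrite (_ : m A = mua (A `&` setT)) // setIT.
have domm : m `<< leb by move=> A hA B BA mB; rewrite mE; exact: (dom A hA).
have [f [f0 ffin fint fE]] := radon_nikodym_sigma_finite domm.
have mf : measurable_fun setT f by exact: measurable_int fint.
pose E (n : nat) := [set x | (n.+1%:R^-1)%:E <= f x].
have mEn n : measurable (E n).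
  rewrite -[E n]setTI; apply: measurable_lee => //; exact: measurable_cst.
have [n En] : exists n, 0 < leb (E n).
  apply/not_existsP => h.
  have h0 n : leb (E n) = 0.
    by apply/eqP; rewrite -measure_le0 leNgt; apply/negP/h.
  have aeE : {ae leb, forall x n, ~ E n x}.
    apply/ae_foralln => n; exists (E n); split; [exact: mEn|exact: h0|].
    by move=> x /contrapT.
  have : mua setT = 0.
    rewrite -mE fE //.
    rewrite (@ge0_ae_eq_integral _ _ _ leb setT f (cst 0)) ?integral0 //.
    apply: (@filterS _ _ (ae_filter_ringOfSetsType leb) _ _ _ aeE) => x nE _.
    apply/eqP; rewrite eq_le f0 andbT leNgt; apply/negP => fx0.
    have fx : (fine (f x))%:E = f x by rewrite fineK.
    have r0 : (0 < fine (f x))%R by rewrite -lte_fin fx.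
    (* A positive value of [f] is at least [1 / (n + 1)] for [n] the integer part
       of its inverse. *)
    apply: (nE (Num.truncn (fine (f x))^-1)); rewrite /E /= -fx lee_fin.
    rewrite invf_ple ?posrE ?ltr0n ?invr_gt0 //.
    by apply/ltW/truncnS_gt.
  by move=> e; rewrite e eqxx in mua0.
exists (E n), (n.+1%:R^-1)%R; split; [exact: mEn|exact: En|by rewrite invr_gt0 ltr0n|move=> A mA].
rewrite rhoE //; apply: (@le_trans _ _ (mua A)); last by rewrite leeDl.
rewrite -mE fE //.
have mAE : measurable (A `&` E n) by exact: measurableI.
apply: (@le_trans _ _ (\int[leb]_(x in A `&` E n) f x)).
  rewrite -(integral_cst leb mAE (n.+1%:R^-1)%:E).
  apply: ge0_le_integral => //.
  - by move=> x _; rewrite lee_fin invr_ge0.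
  - exact: measurable_funTS.
  - by move=> x [].
apply: ge0_subset_integral => //.
exact: measurable_funTS.
Qed.

End AcPart.

(** * Lebesgue density and self-convolution *)

Section Steinhaus.
Variable R : realType.
Local Notation leb := (@lebesgue_measure R).
Local Open Scope ereal_scope.

(** Both sides are measures of [A] that agree on intervals. *)
Lemma lebesgue_measure_scale (t : R) (A : set R) : (0 < t)%R -> measurable A ->
  leb A = t%:E * leb (( *%R t) @^-1` A).
Proof.
move=> t0 mA.
have mt : measurable_fun setT ( *%R t : measurableTypeR R -> measurableTypeR R).
  exact: measurable_funM.
pose pf := [the {measure set (measurableTypeR R) -> \bar R} of
  pushforward leb ( *%R t : measurableTypeR R -> measurableTypeR R)].
pose m := [the {measure set (measurableTypeR R) -> \bar R} of
  mscale (NngNum (ltW t0)) (pf mt)].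
rewrite -[RHS]/(m A).
apply: (@lebesgue_measure_unique _ m) => // _ [[a b]] _ <-.
rewrite -[RHS]/(t%:E * leb (( *%R t) @^-1` `]a, b]%classic)) /=.
have -> : leb `]a, b]%classic = leb `](t * (a / t))%R, (t * (b / t))%R]%classic.
  by rewrite !mulrA ![(t * _)%R]mulrC !mulfK ?gt_eqF.
have -> : ( *%R t) @^-1` `]a, b]%classic = `](a / t)%R, (b / t)%R]%classic.
  by apply/seteqP; split => x /=; rewrite !in_itv/= ltr_pdivrMr // ler_pdivlMr // ![(x * t)%R]mulrC.
rewrite !lebesgue_measure_itv/= !lte_fin ltr_pM2l //; case: ifP => _; last by rewrite mule0.
by rewrite -!EFinB -EFinM mulrBr.
Qed.

(** At a density point [x] of [E] all small balls are filled by [E] to more than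
three quarters, and the ball of radius [r] has length [2 * r]. *)
Lemma exists_density_ball (E : set (measurableTypeR R)) : measurable E -> 0 < leb E ->
  exists x r : R, (0 < r)%R /\ (3 / 2 * r)%:E <= leb (E `&` ball x r).
Proof.
move=> mE E0; have [N [mN N0 NE]] := lebesgue_density mE.
have [x Ex Nx] : exists2 x, E x & ~ N x.
  apply/not_exists2P => h; move: E0; rewrite ltNge => /negP; apply.
  by rewrite -N0 le_measure ?inE // => y Ey; have [|/contrapT] := h y.
have dx : leb (E `&` ball x r) * (leb (ball x r))^-1 @[r --> 0^'+] --> (\1_E x)%:E.
  by apply: contrapT => h; apply: Nx; exact: NE.
rewrite indicE mem_set // in dx.
have /dx h : nbhs (1%:E : \bar R) [set z | (3 / 4)%:E < z].
  apply: open_nbhs_nbhs; split; first exact: open_ereal_gt_ereal.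
  by rewrite /= lte_fin; lra.
have [r /= [r0 hr]] : exists r : R, (0 < r)%R /\ (3 / 4)%:E < leb (E `&` ball x r) * (leb (ball x r))^-1.
  have := filterI (nbhs_right_gt (0 : R)) h.
  by move=> /(_ _) /filter_ex [r [? ?]]; exists r.
exists x, r; split => //.
have r2 : (0 < r *+ 2)%R by rewrite pmulrn_lgt0.
move: hr; rewrite (lebesgue_measure_ball x (ltW r0)).
rewrite inver gt_eqF // lte_pdivlMr //.
by rewrite -EFinM => /ltW; apply: le_trans; rewrite lee_fin; lra.
Qed.

End Steinhaus.

Section SteinhausConv.
Variable R : realType.
Local Notation leb := (@lebesgue_measure R).
Local Notation fmeasure := {finite_measure set (measurableTypeR R) -> \bar R}.
Local Notation plus := (fun z : measurableTypeR R * measurableTypeR R => (z.1 + z.2)%R).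
Local Open Scope ereal_scope.

Lemma measurable_reflect (y : R) : measurable_fun setT (fun u : measurableTypeR R => (y - u)%R : measurableTypeR R).
Proof. exact: measurable_funB. Qed.

Lemma lebesgue_measure_reflect (y : R) (A : set R) : measurable A ->
  leb ((fun u => (y - u)%R) @^-1` A) = leb A.
Proof.
move=> mA; rewrite -(lebesgue_measure_shift y mA).
have mB : measurable ((fun x : measurableTypeR R => (x + y)%R : measurableTypeR R) @^-1` A).
  by rewrite -[X in measurable X]setTI; exact: measurable_shift.
rewrite -(lebesgue_measureN mB) /pushforward; congr (leb _).
by apply/seteqP; split => u /=; rewrite addrC.
Qed.

(** For [y] within [r / 4] of [x + x] the reflection of the ball about [y / 2] is
contained in the ball of radius [5 / 4 * r] about [x]. The set [E] and its
reflection thus both lie in an interval of length [5 / 2 * r], while their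
lengths add up to at least [3 * r]. *)
Lemma leb_overlap (E : set (measurableTypeR R)) (x r y : R) :
  measurable E -> (0 < r)%R -> E `<=` ball x r -> (3 / 2 * r)%:E <= leb E ->
  (y \in `[(x + x - r / 4)%R, (x + x + r / 4)%R[) ->
  (r / 2)%:E <= leb (E `&` ((fun u => (y - u)%R) @^-1` E)).
Proof.
move=> mE r0 Eb leE; rewrite in_itv /= => /andP[y1 y2].
set E' := _ @^-1` E.
have mE' : measurable E'.
  by rewrite -[E']setTI; exact: (measurable_reflect y measurableT mE).
have lE' : leb E' = leb E by exact: lebesgue_measure_reflect.
have Efin : leb E < +oo.
  apply: (@le_lt_trans _ _ (leb (ball x r))); last by rewrite lebesgue_measure_ball ?ltW // ltry.
  by rewrite le_measure ?inE //; exact: measurable_ball.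
have big : leb (E `|` E') <= (5 / 2 * r)%:E.
  apply: (@le_trans _ _ (leb (ball x (5 / 4 * r)%R))).
    apply: le_measure; rewrite ?inE; [exact: measurableU|exact: measurable_ball|].
    move=> u [/Eb|/Eb]; rewrite /ball /= !ltr_norml; move=> /andP[]; lra.
  rewrite lebesgue_measure_ball; last by lra.
  by rewrite lee_fin mulr2n; lra.
have U : leb (E `|` E') = leb E + leb E' - leb (E `&` E') := measureUfinl mE mE' Efin.
have Ifin : leb (E `&` E') \is a fin_num.
  rewrite ge0_fin_numE // (le_lt_trans _ Efin) // le_measure ?inE //.
  exact: measurableI.
move: U big leE lE' Ifin Efin; case: (leb (E `&` E')) => [i| |] //.
case: (leb (E `|` E')) => [q| |] //; case: (leb E) => [s| |] //; case: (leb E') => [s'| |] //.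
rewrite !lee_fin => -[e1] h1 h2 [e2] _ _; lra.
Qed.

(** One factor is replaced at a time. *)
Lemma product_measure_ge (rho k : fmeasure) (e : R) (X : set (measurableTypeR R * measurableTypeR R)) :
  (0 < e)%R -> measurable X -> (forall A, measurable A -> e%:E * k A <= rho A) ->
  (e * e)%:E * (k \x k) X <= (rho \x rho) X.
Proof.
move=> e0 mX krho.
rewrite /product_measure1 /=.
have mk : measurable_fun setT (k \o xsection X) by exact: measurable_fun_xsection.
have mr : measurable_fun setT (rho \o xsection X) by exact: measurable_fun_xsection.
apply: (@le_trans _ _ (\int[rho]_u (e%:E * (k \o xsection X) u))); last first.
  apply: ge0_le_integral => //.
  - by move=> u _; rewrite mule_ge0 // lee_fin ltW.
  - exact: measurable_funeM.
  - by move=> u _; apply: krho; exact: measurable_xsection.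
rewrite ge0_integralZl_EFin // ?(ltW e0) // EFinM -muleA lee_pmul2l //.
rewrite -(@ge0_integral_mscale _ _ _ k setT measurableT (NngNum (ltW e0))) //.
apply: ge0_le_measure_integral => //.
Qed.

(** The convolution of the restrictions has at [y] the density
[leb (E `&` (y - E))], which [leb_overlap] bounds from below. Here the density
appears as the measure of the horizontal sections of a planar set [Z]. *)
Lemma restr_convolution_ge (E : set (measurableTypeR R)) (x r : R) (Efin : leb E < +oo)
  (mE : measurable E) (A : set (measurableTypeR R)) :
  (0 < r)%R -> E `<=` ball x r -> (3 / 2 * r)%:E <= leb E -> measurable A ->
  (r / 2)%:E * leb (A `&` `[(x + x - r / 4)%R, (x + x + r / 4)%R[) <=
  (mfrestr mE Efin \x mfrestr mE Efin) (plus @^-1` A).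
Proof.
move=> r0 Eb leE mA.
pose k : fmeasure := mfrestr mE Efin.
have mplus : measurable (plus @^-1` A).
  by rewrite -[X in measurable X]setTI; exact: (@measurable_plus2 R).
pose Z : set (measurableTypeR R * measurableTypeR R) :=
  [set z | E z.1 /\ A z.2 /\ E (z.2 - z.1)%R].
have mZ : measurable Z.
  have -> : Z = (fst @^-1` E) `&` ((snd @^-1` A) `&` ((fun z => z.2 - z.1)%R @^-1` E)) by [].
  apply: measurableI; [|apply: measurableI].
  - by rewrite -[X in measurable X]setTI; exact: measurable_fst.
  - by rewrite -[X in measurable X]setTI; exact: measurable_snd.
  - rewrite -[X in measurable X]setTI.
    by apply: (measurable_funB measurable_snd measurable_fst).
have -> : (k \x k) (plus @^-1` A) = \int[leb]_u \int[leb]_y (\1_Z (u, y))%:E.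
  rewrite /product_measure1 /= ge0_integral_mrestr //; last exact: measurable_fun_xsection.
  rewrite integral_mkcond; apply: eq_integral => u _.
  rewrite (_ : (fun y => (\1_Z (u, y))%:E) = (fun y => (\1_(xsection Z u) y)%:E)); last first.
    by apply/funext => y; rewrite !indicE mem_xsection.
  rewrite integral_indic // ?setIT; last exact: measurable_xsection.
  rewrite patchE; case: ifPn => [|/negP uE].
    rewrite inE => Eu /=.
    have mB : measurable (A `&` (fun y : measurableTypeR R => (y - u)%R : measurableTypeR R) @^-1` E).
      apply: measurableI => //; rewrite -[X in measurable X]setTI.
      exact: (@measurable_shift _ (- u)%R).
    transitivity (leb ((fun v => (v + u)%R) @^-1` (A `&` (fun y => (y - u)%R) @^-1` E))).
      rewrite /k /mfrestr /mrestr /=; congr (leb _); apply/seteqP; split => v /=.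
        by move=> [/xsectionP]; rewrite /= addrK addrC.
      by rewrite addrK addrC => -[? ?]; split => //; apply/xsectionP.
    rewrite lebesgue_measure_shift //; congr (leb _); apply/seteqP; split => y /=.
      by move=> [? ?]; apply/xsectionP.
    by move=> /xsectionP[_ []].
  rewrite (_ : xsection Z u = set0) ?measure0 //; apply/seteqP; split => y //=.
  by move=> /xsectionP[? _]; apply: uE; rewrite inE.
rewrite (indic_fubini_tonelli leb leb mZ) indic_fubini_tonelli_GE //.
set I := `[(x + x - r / 4)%R, (x + x + r / 4)%R[%classic.
have mI : measurable (I : set (measurableTypeR R)) by exact: measurable_itv.
have mAI : measurable (A `&` I) by exact: measurableI.
have mY : measurable_fun setT (leb \o ysection Z) by exact: measurable_fun_ysection.
apply: (@le_trans _ _ (\int[leb]_(y in A `&` I) (leb \o ysection Z) y)); last first.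
  by apply: ge0_subset_integral.
rewrite -(integral_cst leb mAI (r / 2)%:E).
apply: ge0_le_integral => //.
- by move=> y _; rewrite lee_fin; lra.
- exact: measurable_funTS.
move=> y [Ay Iy] /=.
rewrite (_ : ysection Z y = E `&` ((fun u => (y - u)%R) @^-1` E)); first exact: leb_overlap Eb leE Iy.
apply/seteqP; split => u /=; first by move=> /ysectionP[? []].
by move=> [? ?]; apply/ysectionP.
Qed.

(** A quantitative form of the theorem of Steinhaus: the self-convolution of a
measure that dominates Lebesgue measure on a set of positive measure dominates
Lebesgue measure on an interval. *)
Lemma steinhaus_convolution (rho : fmeasure) (E : set (measurableTypeR R)) (e : R) :
  measurable E -> 0 < leb E -> (0 < e)%R ->
  (forall A, measurable A -> e%:E * leb (A `&` E) <= rho A) ->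
  exists c b delta : R, [/\ (0 < b)%R, (0 < delta)%R &
    forall A, measurable A ->
      delta%:E * leb (A `&` `[(c - b)%R, (c + b)%R[) <= (rho \x rho) (plus @^-1` A)].
Proof.
move=> mE E0 e0 rhoE; have [x [r [r0 dens]]] := exists_density_ball mE E0.
have mE' : measurable (E `&` ball x r) by apply: measurableI => //; exact: measurable_ball.
have E'fin : leb (E `&` ball x r) < +oo.
  apply: (@le_lt_trans _ _ (leb (ball x r))); last by rewrite lebesgue_measure_ball ?ltW // ltry.
  by apply: le_measure; rewrite ?inE //; exact: measurable_ball.
exists (x + x)%R, (r / 4)%R, (e * e * (r / 2))%R; split => [||A mA].
- by rewrite divr_gt0.
- by rewrite !mulr_gt0 // invr_gt0.
have mplus : measurable (plus @^-1` A).
  by rewrite -[X in measurable X]setTI; exact: (@measurable_plus2 R).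
have krho B : measurable B -> e%:E * (mfrestr mE' E'fin) B <= rho B.
  move=> mB; apply: le_trans (rhoE _ mB); rewrite lee_pmul2l // /mfrestr /mrestr.
  apply: le_measure; rewrite ?inE; [exact: measurableI|exact: measurableI|].
  by move=> y [? []].
apply: le_trans (product_measure_ge e0 mplus krho).
rewrite EFinM -muleA; apply: lee_wpmul2l; first by rewrite lee_fin mulr_ge0 // ltW.
by apply: restr_convolution_ge => // y [].
Qed.

End SteinhausConv.

(** * Scaled variables and periodic extensions *)

Section Scaling.
Context d (T : measurableType d) (R : realType) (Q : probability T R).

Definition scale_rv (t : R) (Y : {RV Q >-> R}) (w : T) : R := t * Y w.

Lemma measurable_scale_rv t Y : measurable_fun setT (scale_rv t Y).
Proof. exact: measurable_funM. Qed.

HB.instance Definition _ t Y :=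
  isMeasurableFun.Build _ _ _ _ (scale_rv t Y) (measurable_scale_rv t Y).

Lemma measurable_dilation (t : R) (A : set R) : measurable A -> measurable (( *%R t) @^-1` A).
Proof.
move=> mA; rewrite -[X in measurable X]setTI.
by apply: (_ : measurable_fun setT ( *%R t)) => //; exact: measurable_funM.
Qed.

Lemma scale_indep n (X : 'I_n -> {RV Q >-> R}) t : mutually_independent X ->
  mutually_independent (fun i => scale_rv t (X i) : {RV Q >-> R}).
Proof.
move=> iX B mB.
exact: (iX (fun i => ( *%R t) @^-1` B i) (fun i => measurable_dilation t (mB i))).
Qed.

Lemma psum_scale n (X : 'I_n -> {RV Q >-> R}) t j w :
  psum (fun i => scale_rv t (X i) : {RV Q >-> R}) j w = t * psum X j w.
Proof. by rewrite /psum mulr_sumr. Qed.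

(** The dilation by [t] commutes with addition of the two coordinates. *)
Lemma product_law_scale (S S' : {RV Q >-> R}) (t : R) (A : set R) :
  (forall w, S' w = t * S w) -> measurable A ->
  (law S' \x law S')%E ((fun z => z.1 + z.2) @^-1` A) =
  (law S \x law S)%E ((fun z => z.1 + z.2) @^-1` (( *%R t) @^-1` A)).
Proof.
move=> SS' mA.
have mplus B : measurable B -> measurable ((fun z : measurableTypeR R * measurableTypeR R => z.1 + z.2) @^-1` B).
  by move=> mB; rewrite -[X in measurable X]setTI; exact: (@measurable_plus2 R).
have mA1 := mplus _ mA.
have mA2 := mplus _ (measurable_dilation t mA).
rewrite /product_measure1 /=.
rewrite ge0_integral_law //; last exact: measurable_fun_xsection.
rewrite ge0_integral_law //; last exact: measurable_fun_xsection.
apply: eq_integral => w _ /=; congr (Q _); apply/seteqP; split => w' /=.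
  by move=> /xsectionP /= h; apply/xsectionP => /=; rewrite mulrDr -!SS'.
by move=> /xsectionP /= h; apply/xsectionP => /=; rewrite !SS' -mulrDr.
Qed.

End Scaling.

Section Plus.
Variable R : realType.

Definition plus_rv (z : measurableTypeR R * measurableTypeR R) : R := z.1 + z.2.

HB.instance Definition _ := isMeasurableFun.Build _ _ _ _ plus_rv (@measurable_plus2 R).

End Plus.

Section PeriodicExtension.
Variable R : realType.
Local Notation H := (haarT R).

Definition periodic_ext (f : R -> R) (x : R) : R := f (x - (Num.floor x)%:~R).

Lemma periodic_ext1 f x : periodic_ext f (x + 1) = periodic_ext f x.
Proof.
rewrite /periodic_ext floorDrz ?rpred1 // floor1 intrD; congr f; ring.
Qed.

Lemma measurable_periodic_ext f : measurable_fun setT f -> measurable_fun setT (periodic_ext f).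
Proof.
move=> mf; apply: measurableT_comp mf _; apply: measurable_funB => //.
apply: nondecreasing_measurable => // x y xy.
by rewrite ler_int; exact: le_floor.
Qed.

Lemma periodic_extE f x : x \in `[0, 1[ -> periodic_ext f x = f x.
Proof.
rewrite in_itv /= => x01; rewrite /periodic_ext (@floor_def _ x 0) ?subr0 //.
Qed.

Lemma ae_periodic_ext f : {ae H, forall x, f x = periodic_ext f x}.
Proof.
exists (~` (`[0, 1[ : set (measurableTypeR R))); split.
- by apply: measurableC; exact: measurable_itv.
- by rewrite /haarT /= /mrestr setICl measure0.
by move=> x /= h h01; apply: h; rewrite periodic_extE.
Qed.

(** Reduction modulo 1 of the argument of [f] amounts to evaluating the periodic
extension, so that the expectation becomes an integral over the law of the
scaled variable. *)
Lemma avg_opE d (T : measurableType d) (P : probability T R) (Y : {RV P >-> R}) t f x :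
  measurable_fun setT f ->
  avg_op Y t f x = conv_op (law (scale_rv t Y : {RV P >-> R})) (periodic_ext f) x.
Proof.
move=> mf; rewrite /avg_op unlock /conv_op; congr fine.
have mF := measurable_translate x (measurable_periodic_ext mf).
rewrite [LHS]integralE [RHS]integralE; congr (_ - _)%E.
  rewrite ge0_integral_law //; last exact: measurable_funepos.
  by apply: eq_integral => w _; rewrite /= !funeposE.
rewrite ge0_integral_law //; last exact: measurable_funeneg.
by apply: eq_integral => w _; rewrite /= !funenegE.
Qed.

End PeriodicExtension.

(** * From one step to many steps *)

Section SumDefect.
Variable R : realType.
Local Notation fmeasure := {finite_measure set (measurableTypeR R) -> \bar R}.
Variables (p : \bar R) (p1 : (1 <= p)%E).
Context d (T : measurableType d) (Q : probability T R).
Variables (n : nat) (X : 'I_n -> {RV Q >-> R}).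
Hypothesis indepX : mutually_independent X.
Variable mu : fmeasure.
Hypothesis lawX : forall i A, measurable A -> law (X i) A = mu A.

Lemma conv_op_law0 F : measurable_fun setT F -> conv_op (law (psum X 0 : {RV Q >-> R})) F = F.
Proof.
move=> mF; apply/funext => x; rewrite -[in RHS](addr0 x) -conv_op_dirac //.
congr (_ x); apply: eq_conv_op => A mA.
have S0 w : psum X 0 w = 0 by rewrite /psum big_pred0.
rewrite /= /law /distribution /pushforward /dirac indicE.
have [A0|A0] := pselect (A 0).
  rewrite mem_set // (_ : psum X 0 @^-1` A = setT) ?probability_setT //.
  by apply/seteqP; split => w //= _; rewrite S0.
rewrite memNset // (_ : psum X 0 @^-1` A = set0) ?measure0 //.
by apply/seteqP; split => w //=; rewrite S0.
Qed.

(** Each summand contributes at most the defect of a single step, by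
[defect_convolution]. *)
Lemma defect_psum F j : torus_Lp p F -> (j <= n)%N ->
  defect p (law (psum X j : {RV Q >-> R})) F <= j%:R * defect p mu F.
Proof.
move=> TF; have [mF _ _] := TF; elim: j => [|j IH] jn.
  rewrite mul0r /defect conv_op_law0 //.
  by under eq_fun do rewrite subrr; rewrite (Lp_norm_cst0 p1).
have h := psumS_law (j := Ordinal jn) (psum_later_indep indepX (ltnW jn)).
apply: le_trans (defect_convolution p1 h _ TF) _; first exact: probability_setT.
rewrite -natr1 mulrDl mul1r; apply: lerD; first exact: IH (ltnW jn).
by rewrite /defect (eq_conv_op F (lawX (Ordinal jn))).
Qed.

End SumDefect.

(** * Choice of the arc and conclusion *)

Section Assembly.
Variable R : realType.
Local Notation leb := (@lebesgue_measure R).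
Local Notation fmeasure := {finite_measure set (measurableTypeR R) -> \bar R}.
Local Notation H := (haarT R).

(** The convolution square of [rho] dominates [delta / t] times Lebesgue measure
on an interval of half-length [t * b]. With [M] the least integer above
[1 / (t * b)], the length [w = 1 / M] is at most [t * b], so that
[spectral_gap_arc] applies with [beta = delta / t]. Its constant is at most
[2 * M ^ 3 * t / delta], and [M * (t * b) <= 1 + b] because [t < 1]; hence the
order [t ^ -2]. The factor 4 is the 2 of this bound times the 2 steps in the
square. *)
Lemma gap_of_convolution_square (l : nat) (c0 b delta t : R)
  (rho mu : probability (measurableTypeR R) R) (p : \bar R) (p1 : (1 <= p)%E) (F : R -> R) :
  (0 < l)%N -> 0 < b -> 0 < delta -> 0 < t < 1 ->
  (forall A, measurable A ->
    (delta%:E * leb (( *%R t) @^-1` A `&` `[(c0 - b)%R, (c0 + b)%R[) <=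
     (rho \x rho) ((fun z => z.1 + z.2)%R @^-1` A))%E) ->
  defect p rho F <= l%:R * defect p mu F ->
  torus_Lp p F -> \int[H]_x F x = 0 ->
  b ^+ 3 * delta / (4 * l%:R * (1 + b) ^+ 3) * t ^+ 2 * Lp_norm p F <= defect p mu F.
Proof.
move=> l0 b0 d0 /andP[t0 t1] kge dle TF F0.
have tb0 : 0 < t * b by rewrite mulr_gt0.
pose M := (Num.truncn (t * b)^-1).+1.
have M0 : (0 < M)%N by [].
have Mgt : (t * b)^-1 < M%:R by exact: truncnS_gt.
have Mle : M%:R <= (t * b)^-1 + 1.
  by rewrite /M -natr1 lerD2r truncn_le // invr_ge0 ltW.
have Mpos : 0 < M%:R :> R by rewrite ltr0n.
have [w Mw] : exists w : R, M%:R * w = 1 by exists M%:R^-1; rewrite mulfV // gt_eqF.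
have wtb : w <= t * b.
  by rewrite -(ler_pM2l Mpos) Mw -ler_pdivrMr // mul1r ltW.
pose k : fmeasure := law (@plus_rv R : {RV (rho \x rho)%E >-> R}).
have kE A : measurable A -> k A = (rho \x rho)%E ((fun z => z.1 + z.2)%R @^-1` A) by [].
have k1 : k setT = 1%E by exact: probability_setT.
have bt0 : 0 < delta / t by rewrite divr_gt0.
have arc_le A : measurable A ->
   ((delta / t)%:E * arc_measure (t * c0 - w) (t * c0 + w) A <= k A)%E.
  move=> mA; rewrite kE //; apply: le_trans (kge A mA).
  have mI : measurable (`[t * (c0 - b), t * (c0 + b)[ : set (measurableTypeR R)) by exact: measurable_itv.
  (* The dilation divides lengths by [t], which [delta / t] compensates. *)
  have -> : ( *%R t) @^-1` A `&` `[(c0 - b)%R, (c0 + b)%R[ =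
            ( *%R t) @^-1` (A `&` `[t * (c0 - b), t * (c0 + b)[).
    by apply/seteqP; split => x /= [Ax]; rewrite !in_itv /= ler_pM2l // ltr_pM2l.
  rewrite EFinM -muleA lee_pmul2l //.
  rewrite -(@lee_pmul2l _ t%:E) // muleA -EFinM mulfV ?gt_eqF // mul1e.
  rewrite -lebesgue_measure_scale //; last exact: measurableI.
  rewrite /arc_measure /mrestr; apply: le_measure; rewrite ?inE.
  - by apply: measurableI => //; exact: measurable_itv.
  - exact: measurableI.
  - move=> x [Ax]; rewrite /= !in_itv /= => /andP[x1 x2]; split => //.
    rewrite !mulrDr mulrN; apply/andP; split; lra.
have gap := spectral_gap_arc p1 TF M0 Mw k1 bt0 arc_le F0.
have dk : defect p k F <= 2 * (l%:R * defect p mu F).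
  apply: (le_trans (defect_convolution p1 kE (probability_setT rho) TF)).
  by rewrite mulrDl !mul1r lerD.
rewrite -/(defect p k F) in gap.
have eta0 : 0 <= defect p mu F by exact: Lp_norm_ge0.
have M1 : 1 <= M%:R :> R by rewrite ler1n.
have Ml : M%:R * (t * b) <= 1 + b.
  apply: (@le_trans _ _ (((t * b)^-1 + 1) * (t * b))); first by rewrite ler_pM2r.
  by rewrite mulrDl mulVf ?gt_eqF // !mul1r lerD2l ler_piMl // ltW.
have M3 : M%:R ^+ 3 * (t * b) ^+ 3 <= (1 + b) ^+ 3.
  by rewrite -exprMn lerXn2r ?nnegrE // ?mulr_ge0 ?addr_ge0 // ltW.
have lpos : 0 < l%:R :> R by rewrite ltr0n.
have {}gap : delta * Lp_norm p F <= 2 * M%:R ^+ 3 * t * (2 * (l%:R * defect p mu F)).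
  have : Lp_norm p F <= 2 * M%:R ^+ 3 * (t / delta) * (2 * (l%:R * defect p mu F)).
    apply: (le_trans gap).
    rewrite (_ : M%:R / (delta / t) + M%:R ^+ 3 / (delta / t) =
       (M%:R + M%:R ^+ 3) * (t / delta)); last by field; rewrite !gt_eqF.
    apply: ler_pM => //.
    - by rewrite mulr_ge0 // ?divr_ge0 ?addr_ge0 ?exprn_ge0 ?ltW.
    - exact: Lp_norm_ge0.
    rewrite ler_pM2r ?divr_gt0 // mulrDl !mul1r lerD2r.
    by rewrite exprS ler_peMr ?exprn_ege1 // ltW.
  rewrite -(ler_pM2l d0) => /le_trans; apply.
  by rewrite le_eqVlt; apply/orP; left; apply/eqP; field; rewrite gt_eqF.
have b1 : 0 < 1 + b by rewrite addr_gt0.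
rewrite (_ : _ * Lp_norm p F = b ^+ 3 * t ^+ 2 * (delta * Lp_norm p F) / (4 * l%:R * (1 + b) ^+ 3)); last first.
  by field; rewrite !gt_eqF.
rewrite ler_pdivrMr; last by rewrite !mulr_gt0 // exprn_gt0.
apply: (@le_trans _ _ (b ^+ 3 * t ^+ 2 * (2 * M%:R ^+ 3 * t * (2 * (l%:R * defect p mu F))))).
  by rewrite ler_wpM2l // mulr_ge0 // exprn_ge0 // ltW.
rewrite (_ : _ * _ = (4 * l%:R * defect p mu F) * (M%:R ^+ 3 * (t * b) ^+ 3)); last by ring.
rewrite (_ : defect p mu F * _ = (4 * l%:R * defect p mu F) * (1 + b) ^+ 3); last by ring.
by rewrite ler_wpM2l // !mulr_ge0 // ltW.
Qed.

End Assembly.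

Unset Implicit Arguments.
Theorem theorem2 (R : realType) (l : nat) (l_gt0 : (0 < l)%N)
    (d : measure_display) (T : measurableType d) (P : probability T R)
    (Y : {RV P >-> R}) (Ydecent : decent l Y) :
  exists c : R, 0 < c /\
    forall (d' : measure_display) (T' : measurableType d')
           (P' : probability T' R) (Y' : {RV P' >-> R}), same_law Y' Y ->
    forall (t : R), 0 < t < 1 ->
    forall (p : \bar R), (1 <= p)%E ->
    forall (f : R -> R), f \in Lfun (haarT R) p ->
      \int[haarT R]_x f x = 0 ->
      ((c * t ^+ 2)%:E * 'N[haarT R]_p[EFin \o f]
         <= 'N[haarT R]_p[EFin \o (f \- avg_op Y' t f)%R])%E.
Proof.
have [dq [Tq [Q [Ys [lawYs indepYs acY]]]]] := Ydecent.
pose S : {RV Q >-> R} := psum Ys l.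
have SE : (fun w => \sum_(i < l) Ys i w) = S.
  by apply/funext => w; rewrite /S /= /psum; apply: eq_bigl => i; rewrite ltn_ord.
rewrite SE in acY.
have lawT : (law S setT < +oo)%E by rewrite probability_setT ltry.
have [E [e [mE E0 e0 Emin]]] := ac_part_minorant lawT acY.
have [c0 [b [delta [b0 delta0 square_ge]]]] := steinhaus_convolution mE E0 e0 Emin.
exists (b ^+ 3 * delta / (4 * l%:R * (1 + b) ^+ 3)); split.
  by rewrite divr_gt0 // !mulr_gt0 ?exprn_gt0 ?addr_gt0 ?ltr0n.
move=> d' T' P' Y' Y'Y t t01 p p1 f fLp f0.
have [/andP[]] := (fLp, tt); rewrite !inE /= => mf ffin _.
pose F := periodic_ext f.
have mF : measurable_fun setT F := measurable_periodic_ext mf.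
have fF := ae_periodic_ext f.
have NfF := ae_Lnorm p1 mf mF fF.
have TF : torus_Lp p F.
  by split; [exact: mF|exact: periodic_ext1|rewrite -NfF].
have F0 : \int[haarT R]_x F x = 0.
  rewrite -[RHS]f0 /Rintegral; congr fine; apply: ae_eq_integral => //.
  - exact/measurable_EFinP.
  - exact/measurable_EFinP.
  - by apply: (@filterS _ _ (ae_filter_ringOfSetsType (haarT R)) _ _ _ fF) => x /= ->.
pose mu : probability (measurableTypeR R) R := law (scale_rv t Y' : {RV P' >-> R}).
have gE : (Lp_norm p (fun x => F x - conv_op mu F x))%:E =
    'N[haarT R]_p[EFin \o (f \- avg_op Y' t f)%R]%E.
  have Tg := (torus_LpB p1 TF (torus_Lp_conv p1 mu TF).1).1.
  rewrite (Lp_normE Tg); have [mg _ _] := Tg.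
  have mconv := measurable_conv_op mu mF.
  have avgE : avg_op Y' t f = conv_op mu F by apply/funext => x; exact: avg_opE.
  apply: ae_Lnorm => //; first by rewrite avgE; exact: measurable_funB.
  apply: (@filterS _ _ (ae_filter_ringOfSetsType (haarT R)) _ _ _ fF) => x /= fx.
  by rewrite avgE fx.
rewrite -gE NfF -(Lp_normE TF) -EFinM lee_fin.
pose X i : {RV Q >-> R} := scale_rv t (Ys i).
have indepX : mutually_independent X := scale_indep t indepYs.
have lawX i A : measurable A -> law (X i) A = mu A.
  move=> mA; have mtA := measurable_dilation t mA.
  by have := lawYs i _ mtA; rewrite -(Y'Y _ mtA).
have tS w : psum X l w = t * S w by exact: psum_scale.
apply: (gap_of_convolution_square (c0 := c0) (rho := law (psum X l : {RV Q >-> R})) p1 l_gt0 b0 delta0 t01) => //.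
  move=> A mA; rewrite (product_law_scale (S := S) tS mA).
  exact: square_ge (measurable_dilation t mA).
exact: (defect_psum p1 indepX lawX TF (leqnn l)).
Qed.
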